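(* Let $\rho$ be a symmetric probability measure on $\mathbb{R}$ which is not the Dirac mass at $0$ and such that $$\exists v_0>0\qquad \int_{\mathbb{R}}e^{v_0z^2}\,d\rho(z)<+\infty.$$ Denote by $\sigma^2=\int_{\mathbb{R}} z^2\,d\rho(z)$ the variance of $\rho$ and by $\mu_4=\int_{\mathbb{R}} z^4\,d\rho(z)$ its fourth moment. For each $n\geq 1$ let $(X_n^1,\dots,X_n^n)$ be a random vector with distribution $\widetilde{\mu}_{n,\rho}$, and put $S_n=X_n^1+\dots+X_n^n$. Then, as $n\to\infty$, the random variables $S_n/n^{3/4}$ converge in distribution to the probability measure on $\mathbb{R}$ with density (with respect to Lebesgue measure $ds$) $$s\longmapsto \left(\frac{4\mu_4}{3\sigma^8}\right)^{1/4}\Gamma\left(\frac14\right)^{-1}\exp\left(-\frac{\mu_4}{12\sigma^8}s^4\right).$$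
   Context: For a probability measure $\rho$ on $\mathbb{R}$ which is not the Dirac mass at $0$ and for $n\geq 1$, $\widetilde{\mu}_{n,\rho}$ is the probability measure on $\mathbb{R}^n$ defined by $$d\widetilde{\mu}_{n,\rho}(x_1,\dots,x_n)=\frac{1}{Z_n}\exp\left(\frac12\,\frac{(x_1+\dots+x_n)^2}{x_1^2+\dots+x_n^2}\right)\mathbf{1}_{\{x_1^2+\dots+x_n^2>0\}}\prod_{i=1}^n d\rho(x_i),$$ where $Z_n$ is the normalization constant. A measure $\rho$ on $\mathbb{R}$ is symmetric if it is invariant under $x\mapsto -x$. $\Gamma$ is the Euler Gamma function. *)

(* Defs.v *)
From HB Require Import structures.
From mathcomp Require Import all_boot all_order all_algebra.
From mathcomp Require Import all_classical all_reals all_analysis.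

Set Implicit Arguments.
Unset Strict Implicit.
Unset Printing Implicit Defensive.

Import Order.TTheory GRing.Theory Num.Theory.
Import numFieldNormedType.Exports.

Local Open Scope classical_set_scope.
Local Open Scope ring_scope.

Section product_power.
Context (d : measure_display) (T : measurableType d) (R : realType).

Definition tuple_cons n (x : T * n.-tuple T) : n.+1.-tuple T :=
  [tuple of x.1 :: x.2].

Lemma measurable_tuple_cons n : measurable_fun setT (@tuple_cons n).
Proof. exact: measurable_cons. Qed.

HB.instance Definition _ n :=
  isMeasurableFun.Build _ _ _ _ (@tuple_cons n) (@measurable_tuple_cons n).

(* The n-fold product P (x) ... (x) P, on n.-tuple T with its product
   sigma-algebra: image of P (x) (P (x) ... (x) P) under (a, x) |-> a :: x. *)
Fixpoint power_prob (P : probability T R) (n : nat) :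
    probability (n.-tuple T) R :=
  if n is m.+1 then
    distribution (P \x power_prob P m)%E (@tuple_cons m)
  else dirac [tuple].

End product_power.

Section gibbs.
Context (R : realType).

Definition symmetric_measure (rho : probability R R) : Prop :=
  forall A : set R, measurable A -> rho (-%R @^-1` A) = rho A.

(* Laws are compared on measurable sets only: values of a probability on
   non-measurable sets carry no information. *)
Definition is_dirac0 (rho : probability R R) : Prop :=
  forall A : set R, measurable A -> rho A = \d_(0 : R) A.

Definition tsum n (x : n.-tuple R) : R := \sum_(i < n) tnth x i.

Definition tsum_sq n (x : n.-tuple R) : R := \sum_(i < n) tnth x i ^+ 2.

(* At x = 0 the quotient is 0 by the convention 0^-1 = 0, and the indicator
   vanishes. *)
Definition weight n (x : n.-tuple R) : R :=
  expR (2^-1 * (tsum x ^+ 2 / tsum_sq x)) * \1_[set y | 0 < tsum_sq y] x.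

Definition partition_function (rho : probability R R) n : R :=
  \int[power_prob rho n]_x weight x.

(* Only meant for measurable A; a probability measure when 0 < n and rho is not the
   Dirac mass at 0, since then 0 < Z_n <= expR (n / 2). *)
Definition mu_tilde (rho : probability R R) n (A : set (n.-tuple R)) : \bar R :=
  (((partition_function rho n)^-1)%:E
   * \int[power_prob rho n]_(x in A) (weight x)%:E)%E.

(* Meaningful for 0 < a. *)
Definition Gamma (a : R) : R :=
  \int[lebesgue_measure]_(t in `]0, +oo[) (t `^ (a - 1) * expR (- t)).

Definition limit_density (sigma mu4 s : R) : R :=
  (4 * mu4 / (3 * sigma ^+ 8)) `^ (1 / 4) * (Gamma (1 / 4))^-1
  * expR (- (mu4 / (12 * sigma ^+ 8)) * s ^+ 4).

End gibbs.

Section scaled_sum.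
Context (d : measure_display) (T : measurableType d) (R : realType) (n : nat).

Lemma measurable_tsum : measurable_fun setT (@tsum R n).
Proof. by apply: measurable_sum => i; exact: measurable_tnth. Qed.

Definition scaled_sum (X : {mfun T >-> n.-tuple R}) (w : T) : R :=
  tsum (X w) / n%:R `^ (3 / 4).

Lemma measurable_scaled_sum (X : {mfun T >-> n.-tuple R}) :
  measurable_fun setT (scaled_sum X).
Proof.
apply: measurable_realfun.measurable_funM; last exact: measurable_cst.
exact: (measurableT_comp measurable_tsum).
Qed.

HB.instance Definition _ (X : {mfun T >-> n.-tuple R}) :=
  isMeasurableFun.Build _ _ _ _ (scaled_sum X) (measurable_scaled_sum X).

End scaled_sum.

(* Convergence of the expectations of bounded continuous functions; the Y n may
   live on different probability spaces. *)
Definition cvg_in_distribution (R : realType) (d : nat -> measure_display)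
    (T : forall n, measurableType (d n)) (P : forall n, probability (T n) R)
    (Y : forall n, {RV (P n) >-> R}) (nu : probability R R) : Prop :=
  forall f : R -> R, continuous f -> bounded_fun f ->
    ('E_(P n)[f \o Y n])%E @[n --> \oo] --> (\int[nu]_x (f x)%:E)%E.

Arguments cvg_in_distribution {R d T} P Y nu.

(* Main.v *)
Require Import Defs.
From HB Require Import structures.
From mathcomp Require Import all_boot all_order all_algebra.
From mathcomp Require Import all_classical all_reals all_analysis.
From mathcomp Require Import measurable_realfun ring lra.
Import Order.TTheory GRing.Theory Num.Theory.
Import numFieldNormedType.Exports.
Local Open Scope classical_set_scope.
Local Open Scope ring_scope.

(** Write T for the sum of the squares of the x_i and S for their sum. The weight
exp (S^2 / (2 T)) is quadratic in S in the exponent, and the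
Hubbard-Stratonovich identity makes it linear: exp (b^2 / 2) is the integral of
exp (g b - g^2 / 2) against the normalised Lebesgue measure dg / sqrt (2 pi),
with b = S / sqrt T. Once the exponent is linear in S, the symmetry of rho
allows every x_i to change its sign independently while T stays fixed, and
averaging over the signs replaces exp (g S / sqrt T) by the product of the
cosh (y_i) with y_i = g x_i / sqrt T ([integral_expR_tsum]).

Write ln (cosh y) = y^2 / 2 - cosh_gap y. The y_i^2 add up to exactly g^2, so
the Gaussian factor exp (- g^2 / 2) is cancelled exactly for every nonzero x, and
only exp (- sum of the gaps) is left ([prod_cosh_tilt]). This self-normalisation is
what puts the model at its critical point. Rescale g = n^(1/4) s / sigma. Since
cosh_gap y = y^4 / 12 + O(y^6), the sum of the gaps is close to
(s / sigma)^4 (sum x_i^4 / n) / (12 (T / n)^2), and the law of large numbers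
turns this into mu4 s^4 / (12 sigma^8). The law of large numbers is used through
variances only, in a quantitative form ([gap_density_mean_dist]).

Domination is deterministic: cosh_gap y >= y^4 / (1 + y^2) / 24, and linearising
the right side in y^2 bounds the sum of the gaps below by ((s / sigma)^2 - 1) / 24,
uniformly in n and in nonzero x ([gap_sum_ge]). Dominated convergence in s therefore
gives the limit of the integrals of f (s) ([cvg_smoothed_integral]).

It remains to exchange f (s) with f (S / n^(3/4)). Given x, the variable s is Gaussian
under the linearised weight, with mean close to S / n^(3/4) and variance of order
n^(-1/2). A bounded continuous f satisfies |f a - f b| <= e (1 + b^2) + c (a - b)^2 for every e > 0
and a suitable c ([bounded_continuous_modulus]), so second moments suffice for
the exchange ([integral_joint_error_le], [scaled_smoothed_dist]). Taking f = 1 gives the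
partition function, and the quotient of the two limits is the integral of f
against the normalised quartic density. Its constant is the stated one by the
substitution t = c s^4 in the integral defining Gamma (1/4) ([limit_densityE]). *)

Set Implicit Arguments.
Unset Strict Implicit.
Unset Printing Implicit Defensive.

(** * The gap between cosh and its Gaussian bound *)

Section cosh.
Context {R : realType}.
Implicit Types y : R.

Definition cosh y : R := (expR y + expR (- y)) / 2.
Definition sinh y : R := (expR y - expR (- y)) / 2.
Definition tanh y : R := sinh y / cosh y.
(** The amount by which ln (cosh y) falls short of y^2 / 2; sums of gaps are the only
quantities left after averaging over signs. *)
Definition cosh_gap y : R := y ^+ 2 / 2 - ln (cosh y).

Lemma cosh_gt0 y : 0 < cosh y.
Proof. by rewrite divr_gt0// addr_gt0// expR_gt0. Qed.

Lemma cosh_gapN y : cosh_gap (- y) = cosh_gap y.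
Proof. by rewrite /cosh_gap /cosh sqrrN opprK [expR (- y) + _]addrC. Qed.

Lemma expR_cosh_gap y : cosh y = expR (y ^+ 2 / 2 - cosh_gap y).
Proof. by rewrite /cosh_gap opprB addrC subrK lnK// posrE cosh_gt0. Qed.

Lemma is_derive_expRN y : is_derive y 1 (fun z : R => expR (- z)) (- expR (- y)).
Proof.
have h : is_derive (- y) 1 (@expR R) (expR (- y)) by exact: is_derive_expR.
have := is_derive1_comp h (is_deriveNid y (1 : R)).
by rewrite mulrN1.
Qed.

Lemma is_derive_cosh y : is_derive y 1 cosh (sinh y).
Proof.
have -> : cosh = 2^-1 *: (expR + (fun z : R => expR (- z))).
  by apply/funext => z; rewrite /cosh mulrC.
have h := is_derive_expRN y.
by apply: is_derive_eq; rewrite /sinh [RHS]mulrC.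
Qed.

Lemma is_derive_sinh y : is_derive y 1 sinh (cosh y).
Proof.
have -> : sinh = 2^-1 *: (expR - (fun z : R => expR (- z))).
  by apply/funext => z; rewrite /sinh mulrC.
have h := is_derive_expRN y.
by apply: is_derive_eq; rewrite /cosh opprK [RHS]mulrC.
Qed.

Lemma is_derive_tanh y : is_derive y 1 tanh (1 - tanh y ^+ 2).
Proof.
have h1 := is_derive_cosh y; have h2 := is_derive_sinh y.
have c0 : cosh y != 0 by rewrite gt_eqF// cosh_gt0.
have h3 := is_deriveV c0 h1.
have -> : tanh = sinh * (fun z => (cosh z)^-1) by [].
apply: is_derive_eq.
by rewrite /tanh /GRing.scale !fctE/=; field.
Qed.

Lemma is_derive_cosh_gap y : is_derive y 1 cosh_gap (y - tanh y).
Proof.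
have h1 := is_derive_cosh y.
have h2 := is_derive1_ln (cosh_gt0 y).
have h3 := @is_derive1_comp _ (@ln R) cosh _ _ _ h2 h1.
have -> : cosh_gap = 2^-1 *: (fun z : R => z ^+ 2) - (@ln R \o cosh).
  by apply/funext => z; rewrite /cosh_gap mulrC.
apply: is_derive_eq.
by rewrite /tanh /GRing.scale ?fctE/=; field; rewrite gt_eqF// cosh_gt0.
Qed.

Lemma ge0_of_derive_ge0 (f f' : R -> R) :
  (forall y, is_derive y 1 f (f' y)) -> f 0 = 0 ->
  (forall y, 0 <= y -> 0 <= f' y) -> forall y, 0 <= y -> 0 <= f y.
Proof.
move=> df f0 f'0 y y0.
have [|c] := @MVT_segment R f f' 0 y y0 (fun x _ => df x).
  apply: derivable_within_continuous => x _.
  by have := df x.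
rewrite in_itv/= f0 !subr0 => /andP[c0 _] ->.
by rewrite mulr_ge0// f'0.
Qed.

(** As tanh y = (exp (2 y) - 1) / (exp (2 y) + 1), this is exp (2 y) >= 1 + 2 y. *)
Lemma tanh_ge y : 0 <= y -> y / (1 + y) <= tanh y.
Proof.
move=> y0; rewrite ler_pdivrMr ?ltr_wpDr// /tanh mulrAC ler_pdivlMr ?cosh_gt0//.
rewrite /cosh /sinh.
have e0 := expR_gt0 (- y).
have e1 : 1 + y + y <= expR y * expR y.
  by rewrite -expRD -addrA expR_ge1Dx.
have e2 : expR y * expR (- y) = 1 by rewrite expRN divff// gt_eqF// expR_gt0.
have e3 : expR y = expR y * expR y * expR (- y) by rewrite -mulrA e2 mulr1.
have e4 : (1 + y + y) * expR (- y) <= expR y.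
  by rewrite [leRHS]e3 ler_wpM2r// ltW.
nra.
Qed.

Lemma tanh_ge0 y : 0 <= y -> 0 <= tanh y.
Proof. by move=> y0; apply: le_trans (tanh_ge y0); rewrite divr_ge0// addr_ge0. Qed.

Lemma tanh_le y : 0 <= y -> tanh y <= y.
Proof.
move=> y0; rewrite -subr_ge0.
apply: (@ge0_of_derive_ge0 (fun z => z - tanh z) (fun z => tanh z ^+ 2)); last exact: y0.
- move=> z; have h := is_derive_tanh z.
  have -> : (fun z => z - tanh z) = id - tanh by [].
  by apply: is_derive_eq; rewrite opprB addrC subrK.
- by rewrite /tanh /sinh oppr0 subrr !mul0r subr0.
- by move=> z _; rewrite sqr_ge0.
Qed.

(** Integrates (y - tanh y)' = tanh y ^ 2 <= y ^ 2. *)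
Lemma tanh_ge_cubic y : 0 <= y -> y - tanh y <= y ^+ 3 / 3.
Proof.
move=> y0; rewrite -subr_ge0.
apply: (@ge0_of_derive_ge0 (fun z => z ^+ 3 / 3 - (z - tanh z))
  (fun z => z ^+ 2 - tanh z ^+ 2)); last exact: y0.
- move=> z; have h := is_derive_tanh z.
  have -> : (fun z => z ^+ 3 / 3 - (z - tanh z)) = 3^-1 *: (fun z => z ^+ 3) - (id - tanh).
    by apply/funext => w; rewrite /= [_ / 3]mulrC.
  by apply: is_derive_eq; rewrite /GRing.scale ?fctE/=; field.
- by rewrite /tanh /sinh oppr0 subrr !mul0r !subr0 expr0n/= mul0r.
- by move=> z z0; rewrite subr_ge0 lerXn2r ?nnegrE ?tanh_ge0 ?tanh_le.
Qed.

(** Squaring the cubic bound gives tanh y ^ 2 >= y ^ 2 - 2 / 3 y ^ 4, which is then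
integrated once. *)
Lemma tanh_le_quintic y : 0 <= y -> y ^+ 3 / 3 - 2 * y ^+ 5 / 15 <= y - tanh y.
Proof.
move=> y0; rewrite -subr_ge0.
apply: (@ge0_of_derive_ge0
  (fun z => (z - tanh z) - (z ^+ 3 / 3 - 2 * z ^+ 5 / 15))
  (fun z => tanh z ^+ 2 - z ^+ 2 + 2 / 3 * z ^+ 4)); last exact: y0.
- move=> z; have h := is_derive_tanh z.
  have -> : (fun z => (z - tanh z) - (z ^+ 3 / 3 - 2 * z ^+ 5 / 15)) =
     (id - tanh) - (3^-1 *: (fun z => z ^+ 3) - (2 / 15) *: (fun z => z ^+ 5)).
    by apply/funext => w; rewrite /= [_ ^+ 3 / 3]mulrC [_ * _ / 15]mulrAC.
  by apply: is_derive_eq; rewrite /GRing.scale ?fctE/=; field.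
- by rewrite /tanh /sinh oppr0 subrr !mul0r !expr0n/= mulr0 !mul0r !subr0.
- move=> z z0; have t0 := tanh_ge0 z0; have tz := tanh_le z0.
  have t3 := tanh_ge_cubic z0.
  have [h|h] := leP (z ^+ 3 / 3) z.
    have : (z - z ^+ 3 / 3) ^+ 2 <= tanh z ^+ 2.
      by rewrite lerXn2r ?nnegrE ?subr_ge0//; lra.
    by have := sqr_ge0 (z ^+ 3); nra.
  have : 3 <= z ^+ 2 by nra.
  by have := sqr_ge0 (tanh z); nra.
Qed.

Lemma cosh_gap_le_ge0 y : 0 <= y -> cosh_gap y <= y ^+ 4 / 12.
Proof.
move=> y0; rewrite -subr_ge0.
apply: (@ge0_of_derive_ge0 (fun z => z ^+ 4 / 12 - cosh_gap z)
  (fun z => z ^+ 3 / 3 - (z - tanh z))); last exact: y0.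
- move=> z; have h := is_derive_cosh_gap z.
  have -> : (fun z => z ^+ 4 / 12 - cosh_gap z) = 12^-1 *: (fun z => z ^+ 4) - cosh_gap.
    by apply/funext => w; rewrite /= [_ / 12]mulrC.
  by apply: is_derive_eq; rewrite /GRing.scale ?fctE/=; field.
- by rewrite /cosh_gap /cosh oppr0 expR0 -(natrD _ 1 1) divff// ln1 !expr0n/= !mul0r !subr0.
- by move=> z z0; rewrite subr_ge0 tanh_ge_cubic.
Qed.

Lemma cosh_gap_ge_ge0 y : 0 <= y -> y ^+ 4 / 12 - y ^+ 6 / 45 <= cosh_gap y.
Proof.
move=> y0; rewrite -subr_ge0.
apply: (@ge0_of_derive_ge0 (fun z => cosh_gap z - (z ^+ 4 / 12 - z ^+ 6 / 45))
  (fun z => (z - tanh z) - (z ^+ 3 / 3 - 2 * z ^+ 5 / 15))); last exact: y0.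
- move=> z; have h := is_derive_cosh_gap z.
  have -> : (fun z => cosh_gap z - (z ^+ 4 / 12 - z ^+ 6 / 45)) =
    cosh_gap - (12^-1 *: (fun z => z ^+ 4) - 45^-1 *: (fun z => z ^+ 6)).
    by apply/funext => w; rewrite /= [_ / 12]mulrC [_ / 45]mulrC.
  by apply: is_derive_eq; rewrite /GRing.scale ?fctE/=; field.
- by rewrite /cosh_gap /cosh oppr0 expR0 -(natrD _ 1 1) divff// ln1 !expr0n/= !mul0r !subr0.
- by move=> z z0; rewrite subr_ge0 tanh_le_quintic.
Qed.

(** The left side is y^4 / (1 + y^2) / 24: quartic at 0 and quadratic at infinity, as the
gap itself. Both sides vanish at 0 together with their derivatives, so it suffices to
compare second derivatives, and the one of the gap is tanh y ^ 2 >= (y / (1 + y)) ^ 2. *)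
Lemma cosh_gap_ge_rational_ge0 y : 0 <= y ->
  (y ^+ 2 - 1 + (1 + y ^+ 2)^-1) / 24 <= cosh_gap y.
Proof.
move=> y0; rewrite -subr_ge0.
have p0 z : 1 + z ^+ 2 != 0 :> R by rewrite gt_eqF// ltr_pwDl// sqr_ge0.
have dV (z : R) : is_derive z 1 (fun z : R => (1 + z ^+ 2)^-1) (- (2 * z) / (1 + z ^+ 2) ^+ 2).
  have h : is_derive z 1 (fun w : R => 1 + w ^+ 2) (2 * z).
    have -> : (fun w : R => 1 + w ^+ 2) = cst 1 + (fun w : R => w ^+ 2) by [].
    by apply: is_derive_eq; rewrite /GRing.scale/=; ring.
  have -> : - (2 * z) / (1 + z ^+ 2) ^+ 2 = - (1 + z ^+ 2) ^- 2 *: (2 * z).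
    by rewrite /GRing.scale/= !mulNr mulrC.
  exact: (@is_deriveV _ (fun w : R => 1 + w ^+ 2) z _ _ (p0 z) h).
pose g z : R := (2 * z - 2 * z / (1 + z ^+ 2) ^+ 2) / 24.
apply: (@ge0_of_derive_ge0
  (fun z => cosh_gap z - (z ^+ 2 - 1 + (1 + z ^+ 2)^-1) / 24)
  (fun z => (z - tanh z) - g z)); last exact: y0.
- move=> z; have h := is_derive_cosh_gap z; have h1 := dV z.
  have -> : (fun z => cosh_gap z - (z ^+ 2 - 1 + (1 + z ^+ 2)^-1) / 24) =
    cosh_gap - 24^-1 *: ((fun z => z ^+ 2) - cst 1 + (fun z => (1 + z ^+ 2)^-1)).
    by apply/funext => w; rewrite /= [_ / 24]mulrC.
  by apply: is_derive_eq; rewrite /g /GRing.scale/=; field; rewrite p0.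
- rewrite /cosh_gap /cosh oppr0 expR0 -(natrD _ 1 1) divff// ln1 !expr0n/=.
  by field.
move=> {y0}y y0.
apply: (@ge0_of_derive_ge0 (fun z => (z - tanh z) - g z)
  (fun z => tanh z ^+ 2 - (2 - 2 / (1 + z ^+ 2) ^+ 2 + 8 * z ^+ 2 / (1 + z ^+ 2) ^+ 3) / 24)); last exact: y0.
- move=> z; have h := is_derive_tanh z; have h1 := dV z.
  pose v (w : R) := (1 + w ^+ 2)^-1.
  have h2 : is_derive z 1 (fun w => v w ^+ 2) (2 * v z * (- (2 * z) / (1 + z ^+ 2) ^+ 2)).
    have -> : (fun w => v w ^+ 2) = (v * v)%R by [].
    by apply: is_derive_eq; rewrite /GRing.scale/= /v; ring.
  move: h2; set V2 : R -> R := (fun w => v w ^+ 2) => h2.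
  have V2E w : V2 w = (1 + w ^+ 2) ^- 2 by rewrite /V2 /v exprVn.
  clearbody V2.
  have -> : (fun z => (z - tanh z) - g z) =
    (id - tanh) - 24^-1 *: (2 *: id - 2 *: (id * V2)).
    by apply/funext => w; rewrite /g !fctE /GRing.scale/= V2E; field; rewrite p0.
  by apply: is_derive_eq; rewrite /GRing.scale/= V2E /v; field; rewrite p0.
- by rewrite /g /tanh /sinh oppr0 subrr !mulr0 !mul0r !subr0 mul0r subr0.
move=> {y0}y y0; rewrite subr_ge0.
(* The bound y^2 / (2 (1 + y^2)) comes from (1 + y)^2 <= 2 (1 + y^2); after it both sides
   are rational in y^2. *)
apply: (@le_trans _ _ (y ^+ 2 / (2 * (1 + y ^+ 2)))); last first.
  apply: (@le_trans _ _ ((y / (1 + y)) ^+ 2)); last first.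
    by rewrite lerXn2r ?nnegrE ?tanh_ge0 ?tanh_ge// divr_ge0// addr_ge0.
  rewrite expr_div_n ler_wpM2l ?sqr_ge0// lef_pV2 ?posrE.
  - by have := sqr_ge0 (1 - y); nra.
  - by rewrite mulr_gt0// ltr_pwDl// sqr_ge0.
  - by rewrite exprn_gt0// ltr_wpDr.
rewrite -subr_ge0.
set t := y ^+ 2.
have t0 : 0 <= t by rewrite sqr_ge0.
have -> : t / (2 * (1 + t)) - (2 - 2 / (1 + t) ^+ 2 + 8 * t / (1 + t) ^+ 3) / 24 =
   (9 * t ^+ 2 + 5 * t ^+ 3) / (12 * (1 + t) ^+ 3).
  by field; rewrite p0.
by rewrite divr_ge0// ?addr_ge0// mulr_ge0// exprn_ge0// addr_ge0.
Qed.

Lemma even_wlog (P : R -> Prop) : (forall y, P (- y) -> P y) ->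
  (forall y, 0 <= y -> P y) -> forall y, P y.
Proof.
move=> PN P0 y; have [y0|y0] := leP 0 y; first exact: P0.
by apply: PN; apply: P0; rewrite oppr_ge0 ltW.
Qed.

Lemma cosh_gap_le y : cosh_gap y <= y ^+ 4 / 12.
Proof.
move: y; apply: even_wlog; last exact: cosh_gap_le_ge0.
move=> y; rewrite cosh_gapN; suff -> : (- y) ^+ 4 = y ^+ 4 by [].
by ring.
Qed.

Lemma cosh_gap_ge y : y ^+ 4 / 12 - y ^+ 6 / 45 <= cosh_gap y.
Proof.
move: y; apply: even_wlog; last exact: cosh_gap_ge_ge0.
move=> y; rewrite cosh_gapN.
have -> : (- y) ^+ 4 = y ^+ 4 by ring.
by have -> : (- y) ^+ 6 = y ^+ 6 by ring.
Qed.

(** A minorant that is affine in y ^ 2 for every l, hence can be summed when only the sum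
of the squares is known. It holds because y^4 / (1 + y^2) differs from the numerator by
(y^2 - l (1 + y^2))^2 / (1 + y^2). *)
Lemma cosh_gap_ge_tangent (l : R) y :
  (2 * l * y ^+ 2 - l ^+ 2 * (1 + y ^+ 2)) / 24 <= cosh_gap y.
Proof.
have : (y ^+ 2 - 1 + (1 + y ^+ 2)^-1) / 24 <= cosh_gap y.
  move: y; apply: even_wlog; last exact: cosh_gap_ge_rational_ge0.
  by move=> y; rewrite cosh_gapN sqrrN.
apply: le_trans; rewrite ler_wpM2r// -subr_ge0.
have p0 : 0 < 1 + y ^+ 2 by rewrite ltr_pwDl// sqr_ge0.
have -> : y ^+ 2 - 1 + (1 + y ^+ 2)^-1 - (2 * l * y ^+ 2 - l ^+ 2 * (1 + y ^+ 2)) =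
   (y ^+ 2 - l * (1 + y ^+ 2)) ^+ 2 / (1 + y ^+ 2).
  by field; rewrite gt_eqF.
by rewrite divr_ge0 ?sqr_ge0// ltW.
Qed.

Lemma cosh_gap_ge0 y : 0 <= cosh_gap y.
Proof.
have := cosh_gap_ge_tangent 0 y.
by rewrite mulr0 !mul0r expr0n/= mul0r subr0 mul0r.
Qed.

End cosh.

(** The Radon-Nikodym derivative of nu is almost everywhere equal to the given density,
since both have the same integral on every measurable set. *)
Lemma ge0_integral_density d (T : measurableType d) (R : realType)
    (mu : {sigma_finite_measure set T -> \bar R}) (nu : probability T R)
    (p : T -> R) : measurable_fun setT p -> (forall x, 0 <= p x) ->
  (forall A, measurable A -> nu A = (\int[mu]_(x in A) (p x)%:E)%E) ->
  forall f : T -> \bar R, measurable_fun [set: T] f -> (forall x, (0 <= f x)%E) ->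
  (\int[nu]_x f x = \int[mu]_x (f x * (p x)%:E))%E.
Proof.
move=> mp p0 nuE f mf f0.
have numu : nu `<< mu.
  apply/null_content_dominatesP => A mA muA0; rewrite nuE//.
  by apply: null_set_integral => //; apply/measurable_funTS/measurable_EFinP.
rewrite -(Radon_Nikodym_SigmaFinite.change_of_variables numu)//.
have mrn := Radon_Nikodym_SigmaFinite.f_integrable numu.
apply: ae_eq_integral => //.
- by apply: emeasurable_funM => //; exact: measurable_int mrn.
- by apply: emeasurable_funM => //; exact/measurable_EFinP.
apply: ae_eqe_mul2l; apply: integral_ae_eq => //.
- exact/measurable_EFinP.
- move=> E _ mE; rewrite -(Radon_Nikodym_SigmaFinite.f_integral numu mE).
  exact: nuE.
Qed.

(** * Product measures and averaging over signs *)

Section product_power.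
Context d (T : measurableType d) (R : realType) (P : probability T R).

Lemma ge0_integral_power_probS n (f : n.+1.-tuple T -> \bar R) :
  measurable_fun setT f -> (forall x, (0 <= f x)%E) ->
  (\int[power_prob P n.+1]_x f x =
   \int[P]_a \int[power_prob P n]_y f (tuple_cons (a, y)))%E.
Proof.
move=> mf f0; rewrite [LHS]ge0_integral_distribution//.
rewrite fubini_tonelli1//.
- by apply: (measurableT_comp mf); exact: measurable_tuple_cons.
- by move=> x; exact: f0.
Qed.

Lemma ge0_integral_power_probS_swap n (f : n.+1.-tuple T -> \bar R) :
  measurable_fun setT f -> (forall x, (0 <= f x)%E) ->
  (\int[power_prob P n.+1]_x f x =
   \int[power_prob P n]_y \int[P]_a f (tuple_cons (a, y)))%E.
Proof.
move=> mf f0; rewrite [LHS]ge0_integral_distribution//.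
rewrite fubini_tonelli2//.
- by apply: (measurableT_comp mf); exact: measurable_tuple_cons.
- by move=> x; exact: f0.
Qed.

End product_power.

Section sums.
Context {R : realType}.

Definition tsumf (g : R -> R) n (x : n.-tuple R) : R := \sum_(i < n) g (tnth x i).

Lemma tsumE n (x : n.-tuple R) : tsum x = tsumf id x. Proof. by []. Qed.
Lemma tsum_sqE n (x : n.-tuple R) : tsum_sq x = tsumf (fun z => z ^+ 2) x.
Proof. by []. Qed.

Lemma tsumf_cons g n a (y : n.-tuple R) :
  tsumf g (tuple_cons (a, y)) = g a + tsumf g y.
Proof.
rewrite /tsumf big_ord_recl; congr (g _ + _).
by apply: eq_bigr => i _; rewrite tnthS.
Qed.

Lemma measurable_tsumf g n : measurable_fun setT g ->
  measurable_fun setT (@tsumf g n).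
Proof.
move=> mg; apply: measurable_sum => i.
by apply: measurableT_comp => //; exact: measurable_tnth.
Qed.

Lemma measurable_tsum_sq n : measurable_fun setT (@tsum_sq R n).
Proof. by apply: (@measurable_tsumf (fun z => z ^+ 2)); exact: exprn_measurable. Qed.

Lemma measurable_cosh : measurable_fun setT (@cosh R).
Proof.
apply: measurable_funM => //; apply: measurable_funD => //.
by apply: measurableT_comp.
Qed.

Lemma measurable_prod_cosh d (T : measurableType d) n (F : T -> n.-tuple R)
    (t : T -> R) : measurable_fun setT F -> measurable_fun setT t ->
  measurable_fun setT (fun x => \prod_(i < n) cosh (t x * tnth (F x) i)).
Proof.
move=> mF mt; apply: measurable_prod => i _.
apply: measurableT_comp; first exact: measurable_cosh.
apply: measurable_funM => //.
exact: (measurableT_comp (measurable_tnth i) mF).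
Qed.

End sums.

Section symmetric.
Context (R : realType) (rho : probability R R).
Hypothesis rho_sym : symmetric_measure rho.

Lemma ge0_integral_symmetric (f : R -> \bar R) : measurable_fun setT f ->
  (forall x, (0 <= f x)%E) -> (\int[rho]_x f (- x)%R = \int[rho]_x f x)%E.
Proof.
move=> mf f0.
have mN : measurable_fun setT (-%R : R -> R) by exact: oppr_measurable.
rewrite -[LHS](@ge0_integral_pushforward _ _ _ _ _ (-%R : R -> R) mN rho setT f)//.
by apply: eq_measure_integral => A mA _; exact: rho_sym.
Qed.

(** The integrals of exp (t a) k and of exp (- t a) k agree by symmetry, and cosh is the
half-sum of the two exponentials. *)
Lemma integral_expR_even (t k : R -> R) :
  measurable_fun setT t -> measurable_fun setT k -> (forall a, 0 <= k a) ->
  (forall a, t (- a) = t a) -> (forall a, k (- a) = k a) ->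
  (\int[rho]_a (expR (t a * a) * k a)%:E =
   \int[rho]_a (cosh (t a * a) * k a)%:E)%E.
Proof.
move=> mt mk k0 tN kN.
have mta : measurable_fun setT (fun a : R => t a * a) by exact: measurable_funM.
have m1 : measurable_fun setT (fun a : R => (expR (t a * a) * k a)%:E).
  by apply/measurable_EFinP/measurable_funM => //; exact: measurableT_comp.
have m2 : measurable_fun setT (fun a : R => (expR (- (t a * a)) * k a)%:E).
  apply/measurable_EFinP/measurable_funM => //.
  by apply: measurableT_comp => //; exact: measurableT_comp.
have h := ge0_integral_symmetric m1.
under [RHS]eq_integral => a _.
  have -> : (cosh (t a * a) * k a)%:E =
    (2^-1%:E * ((expR (t a * a) * k a)%:E + (expR (- (t a * a)) * k a)%:E))%E.
    by rewrite -EFinD -EFinM /cosh; congr (_%:E); field.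
  over.
rewrite /= ge0_integralZl//=; last 2 first.
- exact: emeasurable_funD.
- by move=> a _; rewrite -EFinD lee_fin addr_ge0// mulr_ge0// expR_ge0.
rewrite ge0_integralD//=; last 2 first.
- by move=> a _; rewrite lee_fin mulr_ge0// expR_ge0.
- by move=> a _; rewrite lee_fin mulr_ge0// expR_ge0.
rewrite (_ : (\int[rho]_a (expR (- (t a * a)) * k a)%:E = \int[rho]_a (expR (t a * a) * k a)%:E)%E).
  set I := (\int[rho]_a _)%E.
  have : (0 <= I)%E by apply: integral_ge0 => a _; rewrite lee_fin mulr_ge0// expR_ge0.
  case: I => [r| |]//= r0.
    by rewrite -EFinD -EFinM; congr (_%:E); field.
  by rewrite addeC/= gt0_muley// lte_fin invr_gt0.
rewrite -h; last by move=> a; rewrite lee_fin mulr_ge0// expR_ge0.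
by apply: eq_integral => a _; rewrite tN kN mulrN.
Qed.

(** Averaging over independent signs. By induction on n: with the first coordinate fixed,
the others are averaged by the induction hypothesis, th and ph being allowed to
depend on the sum of squares so that the first square can be absorbed; then the order
of integration is exchanged and the first coordinate is averaged. *)
Lemma integral_expR_tsum n (th ph : R -> R) :
  measurable_fun setT th -> measurable_fun setT ph -> (forall t, 0 <= ph t) ->
  (\int[power_prob rho n]_x
     (expR (th (tsum_sq x) * tsum x) * ph (tsum_sq x))%:E =
   \int[power_prob rho n]_x
     ((\prod_(i < n) cosh (th (tsum_sq x) * tnth x i)) * ph (tsum_sq x))%:E)%E.
Proof.
elim: n th ph => [|n IHn] th ph mth mph ph0.
  by apply: eq_integral => x _; rewrite /tsum /tsum_sq !big_ord0 mulr0 expR0.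
have mT := measurable_tsum_sq (R:=R) (n:=n.+1).
have mth' m : measurable_fun setT (fun x : m.-tuple R => th (tsum_sq x)).
  by apply: measurableT_comp => //; exact: measurable_tsum_sq.
have mph' m : measurable_fun setT (fun x : m.-tuple R => ph (tsum_sq x)).
  by apply: measurableT_comp => //; exact: measurable_tsum_sq.
have prod0 m (x : m.-tuple R) t : 0 <= \prod_(i < m) cosh (t * tnth x i).
  by apply: prodr_ge0 => i _; rewrite ltW// cosh_gt0.
rewrite ge0_integral_power_probS//; last 2 first.
- apply/measurable_EFinP/measurable_funM; last exact: mph'.
  apply: measurableT_comp => //; apply: measurable_funM; first exact: mth'.
  exact: measurable_tsum.
- by move=> x; rewrite lee_fin mulr_ge0// expR_ge0.
have sqE a (y : n.-tuple R) : tsum_sq (tuple_cons (a, y)) = a ^+ 2 + tsum_sq y.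
  by rewrite !tsum_sqE tsumf_cons.
have sE a (y : n.-tuple R) : tsum (tuple_cons (a, y)) = a + tsum y.
  by rewrite !tsumE tsumf_cons.
(* The state after averaging every coordinate but the first. *)
pose G (x : n.+1.-tuple R) : \bar R := (expR (th (tsum_sq x) * tnth x ord0) *
   ((\prod_(i < n) cosh (th (tsum_sq x) * tnth x (lift ord0 i))) * ph (tsum_sq x)))%:E.
have mG : measurable_fun setT G.
  apply/measurable_EFinP/measurable_funM.
    apply: measurableT_comp => //; apply: measurable_funM; first exact: mth'.
    exact: measurable_tnth.
  apply: measurable_funM; last exact: mph'.
  apply: measurable_prod => i _.
  apply: measurableT_comp; first exact: measurable_cosh.
  by apply: measurable_funM; [exact: mth'|exact: measurable_tnth].
have G0 x : (0 <= G x)%E.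
  rewrite lee_fin mulr_ge0 ?expR_ge0// mulr_ge0//.
  by apply: prodr_ge0 => i _; rewrite ltW// cosh_gt0.
transitivity (\int[rho]_a \int[power_prob rho n]_y G (tuple_cons (a, y)))%E.
  apply: eq_integral => a _.
  pose tha t := th (a ^+ 2 + t).
  pose pha t := expR (th (a ^+ 2 + t) * a) * ph (a ^+ 2 + t).
  have mtha : measurable_fun setT tha by apply: measurableT_comp => //; exact: measurable_funD.
  have mpha : measurable_fun setT pha.
    apply: measurable_funM; last by apply: measurableT_comp => //; exact: measurable_funD.
    by apply: measurableT_comp => //; exact: measurable_funM.
  have pha0 t : 0 <= pha t by rewrite mulr_ge0// expR_ge0.
  have := IHn tha pha mtha mpha pha0; rewrite /tha /pha => IH.
  under eq_integral => y _ do rewrite sqE sE mulrDr expRD [expR _ * _]mulrC -mulrA.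
  rewrite IH; apply: eq_integral => y _.
  rewrite /G sqE /=; congr (_%:E); rewrite mulrCA; congr (_ * (_ * _)).
  by apply: eq_bigr => i _; rewrite tnthS.
rewrite -ge0_integral_power_probS// ge0_integral_power_probS_swap//.
rewrite ge0_integral_power_probS_swap//; last 2 first.
- apply/measurable_EFinP/measurable_funM; last exact: mph'.
  by apply: (@measurable_prod_cosh _ _ _ _ id); [exact: measurable_id|exact: mth'].
- by move=> x; rewrite lee_fin mulr_ge0.
apply: eq_integral => y _.
rewrite /G /=.
under eq_integral => a _.
  rewrite sqE; under eq_bigr => i _ do rewrite tnthS.
  over.
under [RHS]eq_integral => a _.
  rewrite sqE big_ord_recl -mulrA; under eq_bigr => i _ do rewrite tnthS.
  over.
have mth2 : measurable_fun setT (fun a : R => th (a ^+ 2 + tsum_sq y)).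
  by apply: measurableT_comp => //; exact: measurable_funD.
apply: (@integral_expR_even (fun a => th (a ^+ 2 + tsum_sq y))
  (fun a => (\prod_(i < n) cosh (th (a ^+ 2 + tsum_sq y) * tnth y i)) *
             ph (a ^+ 2 + tsum_sq y))).
- exact: mth2.
- apply: measurable_funM.
    exact: (measurable_prod_cosh (F := cst y)).
  by apply: measurableT_comp => //; exact: measurable_funD.
- by move=> a; rewrite mulr_ge0.
- by move=> a; rewrite sqrrN.
- by move=> a; rewrite sqrrN.
Qed.

End symmetric.

(** * Moments of sums of independent terms *)

Section moments.
Context (R : realType) (rho : probability R R).

Lemma integral_cst_prob d (T : measurableType d) (P : probability T R) (r : R) :
  (\int[P]_x r%:E = r%:E)%E.
Proof. by rewrite integral_cst//= probability_setT mule1. Qed.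

Lemma integral_tsumf (g : R -> R) (m : R) n :
  measurable_fun setT g -> (forall z, 0 <= g z) ->
  (\int[rho]_z (g z)%:E = m%:E)%E ->
  (\int[power_prob rho n]_x (tsumf g x)%:E = (n%:R * m)%:E)%E.
Proof.
move=> mg g0 gm; have tg0 k (x : k.-tuple R) : 0 <= tsumf g x by exact: sumr_ge0.
elim: n => [|n IHn].
  rewrite mul0r -[RHS](integral0 (power_prob rho 0) setT).
  by apply: eq_integral => x _; rewrite /tsumf big_ord0.
rewrite ge0_integral_power_probS//; last 2 first.
- by apply/measurable_EFinP; exact: measurable_tsumf.
- by move=> x; rewrite lee_fin.
transitivity (\int[rho]_a ((g a)%:E + (n%:R * m)%:E))%E.
  apply: eq_integral => a _.
  under eq_integral => y _ do rewrite tsumf_cons EFinD.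
  rewrite ge0_integralD//=; last 3 first.
  - by move=> y _; rewrite lee_fin.
  - by move=> y _; rewrite lee_fin.
  - by apply/measurable_EFinP; exact: measurable_tsumf.
by rewrite integral_cst_prob IHn.
rewrite ge0_integralD//=; last 3 first.
- by move=> a _; rewrite lee_fin.
- exact/measurable_EFinP.
- move=> a _; rewrite lee_fin mulr_ge0//.
  by rewrite -lee_fin -gm; apply: integral_ge0 => z _; rewrite lee_fin.
by rewrite integral_cst_prob gm -EFinD -natr1 mulrDl mul1r addrC.
Qed.

Lemma integral_tsumf_sqr (g : R -> R) (m M : R) n :
  measurable_fun setT g -> (forall z, 0 <= g z) ->
  (\int[rho]_z (g z)%:E = m%:E)%E -> (\int[rho]_z (g z ^+ 2)%:E = M%:E)%E ->
  (\int[power_prob rho n]_x (tsumf g x ^+ 2)%:E =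
     (n%:R * M + n%:R * (n%:R - 1) * m ^+ 2)%:E)%E.
Proof.
move=> mg g0 gm gM; have tg0 k (x : k.-tuple R) : 0 <= tsumf g x by exact: sumr_ge0.
have mtg k : measurable_fun setT (@tsumf R g k) by exact: measurable_tsumf.
have m0 : 0 <= m by rewrite -lee_fin -gm; apply: integral_ge0 => z _; rewrite lee_fin.
elim: n => [|n IHn].
  rewrite !mul0r addr0 -[RHS](integral0 (power_prob rho 0) setT).
  by apply: eq_integral => x _; rewrite /tsumf big_ord0 expr0n.
set B := n%:R * M + n%:R * (n%:R - 1) * m ^+ 2 in IHn.
have B0 : 0 <= B.
  by rewrite -lee_fin -IHn; apply: integral_ge0 => z _; rewrite lee_fin sqr_ge0.
rewrite ge0_integral_power_probS//; last 2 first.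
- by apply/measurable_EFinP/measurable_funX; exact: mtg.
- by move=> x; rewrite lee_fin sqr_ge0.
transitivity (\int[rho]_a ((g a ^+ 2)%:E + ((2 * (n%:R * m))%:E * (g a)%:E + B%:E)))%E.
  apply: eq_integral => a _.
  under eq_integral => y _.
    have -> : (tsumf g (tuple_cons (a, y)) ^+ 2)%:E =
       ((g a ^+ 2)%:E + ((2 * g a)%:E * (tsumf g y)%:E + (tsumf g y ^+ 2)%:E))%E.
      by rewrite tsumf_cons -EFinM -!EFinD; congr (_%:E); ring.
    over.
  rewrite /= ge0_integralD//=; last 3 first.
  - by move=> y _; rewrite lee_fin sqr_ge0.
  - by move=> y _; rewrite -EFinM -EFinD lee_fin addr_ge0 ?sqr_ge0// !mulr_ge0.
  - apply: emeasurable_funD.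
      by apply: emeasurable_funM => //; apply/measurable_EFinP; exact: mtg.
    by apply/measurable_EFinP/measurable_funX; exact: mtg.
  rewrite ge0_integralD//=; last 4 first.
  - by move=> y _; rewrite -EFinM lee_fin !mulr_ge0.
  - by apply: emeasurable_funM => //; apply/measurable_EFinP; exact: mtg.
  - by move=> y _; rewrite lee_fin sqr_ge0.
  - by apply/measurable_EFinP/measurable_funX; exact: mtg.
  rewrite ge0_integralZl//=; last 3 first.
  - by apply/measurable_EFinP; exact: mtg.
  - by move=> y _; rewrite lee_fin.
  - by rewrite lee_fin mulr_ge0.
  rewrite integral_cst_prob IHn (integral_tsumf n mg g0 gm) -!EFinM.
  by congr (_ + (_%:E + _))%E; ring.
rewrite ge0_integralD//=; last 4 first.
- by move=> a _; rewrite lee_fin sqr_ge0.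
- exact/measurable_EFinP/measurable_funX.
- by move=> a _; rewrite -EFinM -EFinD lee_fin addr_ge0// !mulr_ge0.
- apply: emeasurable_funD => //.
  by apply: emeasurable_funM => //; exact/measurable_EFinP.
rewrite ge0_integralD//=; last 2 first.
- by move=> a _; rewrite -EFinM lee_fin !mulr_ge0.
- by apply: emeasurable_funM => //; exact/measurable_EFinP.
rewrite ge0_integralZl//=; last 3 first.
- exact/measurable_EFinP.
- by move=> a _; rewrite lee_fin.
- by rewrite lee_fin !mulr_ge0.
rewrite integral_cst_prob gm gM -EFinM -!EFinD; congr (_%:E).
by rewrite /B -natr1; ring.
Qed.

(** The variance of a sum of independent terms. Adding the cross term to both sides keeps
all the integrands nonnegative, so that integrals can be added in the extended reals. *)
Lemma integral_tsumf_centered_sqr (g : R -> R) (m M : R) n :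
  measurable_fun setT g -> (forall z, 0 <= g z) ->
  (\int[rho]_z (g z)%:E = m%:E)%E -> (\int[rho]_z (g z ^+ 2)%:E = M%:E)%E ->
  (\int[power_prob rho n]_x ((tsumf g x - n%:R * m) ^+ 2)%:E =
     (n%:R * (M - m ^+ 2))%:E)%E.
Proof.
move=> mg g0 gm gM; have tg0 k (x : k.-tuple R) : 0 <= tsumf g x by exact: sumr_ge0.
have mtg k : measurable_fun setT (@tsumf R g k) by exact: measurable_tsumf.
have m0 : 0 <= m by rewrite -lee_fin -gm; apply: integral_ge0 => z _; rewrite lee_fin.
have mc : measurable_fun setT (fun x : n.-tuple R => ((tsumf g x - n%:R * m) ^+ 2)%:E).
  by apply/measurable_EFinP/measurable_funX/measurable_funB => //; exact: mtg.
have : (\int[power_prob rho n]_x (((tsumf g x - n%:R * m) ^+ 2)%:E +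
         (2 * (n%:R * m))%:E * (tsumf g x)%:E) =
  \int[power_prob rho n]_x ((tsumf g x ^+ 2)%:E + ((n%:R * m) ^+ 2)%:E))%E.
  apply: eq_integral => x _; rewrite -EFinM -!EFinD; congr (_%:E); ring.
rewrite ge0_integralD//=; last 3 first.
- by move=> x _; rewrite lee_fin sqr_ge0.
- by move=> x _; rewrite -EFinM lee_fin !mulr_ge0.
- by apply: emeasurable_funM => //; apply/measurable_EFinP; exact: mtg.
rewrite ge0_integralZl//=; last 3 first.
- by apply/measurable_EFinP; exact: mtg.
- by move=> x _; rewrite lee_fin.
- by rewrite lee_fin !mulr_ge0.
rewrite ge0_integralD//=; last 3 first.
- by move=> x _; rewrite lee_fin sqr_ge0.
- by apply/measurable_EFinP/measurable_funX; exact: mtg.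
- by move=> x _; rewrite lee_fin sqr_ge0.
rewrite integral_cst_prob (integral_tsumf n mg g0 gm) (integral_tsumf_sqr n mg g0 gm gM).
rewrite -EFinM -EFinD.
case: (\int[power_prob rho n]_x _)%E => [r| |]//.
rewrite -EFinD => -[] h; congr (_%:E).
by move: h; move/(canRL (addrK _)) ->; ring.
Qed.

Hypothesis rho_exp : exists2 v0 : R, 0 < v0 &
  (\int[rho]_z (expR (v0 * z ^+ 2))%:E < +oo)%E.

(** From 1 + x^m / m! <= exp x at x = v0 z^2. *)
Lemma even_moment_fin k :
  exists2 M : R, 0 <= M & (\int[rho]_z (z ^+ (k.+1.*2))%:E = M%:E)%E.
Proof.
case: rho_exp => v0 v00 fin.
have zk z : z ^+ (k.+1.*2) = (z ^+ 2) ^+ k.+1 :> R by rewrite -exprM mul2n.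
have z0 z : 0 <= z ^+ (k.+1.*2) :> R by rewrite zk exprn_ge0// sqr_ge0.
have I0 : (0 <= \int[rho]_z (z ^+ (k.+1.*2))%:E)%E.
  by apply: integral_ge0 => z _; rewrite lee_fin.
have : (\int[rho]_z (z ^+ (k.+1.*2))%:E < +oo)%E.
  pose c : R := (k.+1)`!%:R / v0 ^+ k.+1.
  have c0 : 0 <= c by rewrite divr_ge0// exprn_ge0// ltW.
  have mexp : measurable_fun setT (fun z : R => (expR (v0 * z ^+ 2))%:E).
    apply/measurable_EFinP; apply: measurableT_comp => //.
    by apply: measurable_funM => //; exact: exprn_measurable.
  apply: (@le_lt_trans _ _ (\int[rho]_z (c%:E * (expR (v0 * z ^+ 2))%:E))%E).
    apply: ge0_le_integral => //.
    - by move=> z _; rewrite lee_fin.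
    - by apply/measurable_EFinP; exact: exprn_measurable.
    - by apply: emeasurable_funM.
    - move=> z _; rewrite -EFinM lee_fin.
      have v1 : 0 <= v0 * z ^+ 2 by rewrite mulr_ge0 ?sqr_ge0// ltW.
      have := expR_ge1Dxn k v1.
      rewrite zk exprMn /c => h.
      have h2 : v0 ^+ k.+1 * (z ^+ 2) ^+ k.+1 / (k.+1)`!%:R <= expR (v0 * z ^+ 2).
        by apply: le_trans h; rewrite lerDr.
      have v3 : 0 < v0 ^+ k.+1 by rewrite exprn_gt0.
      have v4 : 0 < (k.+1)`!%:R :> R by rewrite ltr0n fact_gt0.
      rewrite mulrAC ler_pdivlMr// mulrC [leRHS]mulrC.
      by rewrite -ler_pdivrMr.
  by rewrite ge0_integralZl//= lte_mul_pinfty.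
move: I0; case: (\int[rho]_z _)%E => [r| |]//; rewrite lee_fin => r0 _.
by exists r.
Qed.

End moments.

(** * Deterministic estimates on the sum of gaps *)

Section pointwise.
Context {R : realType}.

Lemma ler_dist_expRN (G G0 : R) : 0 <= G -> 0 <= G0 ->
  `|expR (- G) - expR (- G0)| <= `|G - G0|.
Proof.
wlog GG0 : G G0 / G <= G0.
  move=> h G1 G2; have [h0|/ltW h0] := leP G G0; first exact: h.
  by rewrite distrC [leRHS]distrC; exact: h.
move=> G1 _; rewrite [leRHS]distrC !ger0_norm ?subr_ge0 ?ler_expR ?lerN2//.
have -> : expR (- G) - expR (- G0) = expR (- G) * (1 - expR (- (G0 - G))).
  by rewrite mulrBr mulr1 -expRD; congr (_ - expR _); ring.
have h1 := expR_ge1Dx (- (G0 - G)).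
have h2 : expR (- G) <= 1 by rewrite -expR0 ler_expR oppr_le0.
have h3 : expR (- (G0 - G)) <= 1 by rewrite -expR0 ler_expR oppr_le0 subr_ge0.
have := expR_ge0 (- G); nra.
Qed.

(** The three summands bound, in this order, the error made on the quartic term, the
sixth-order remainder, and the trivial bound 1 when the empirical variance t is below
v / 2. *)
Definition quartic_rate (v mu4 a : R) : R :=
  a ^+ 4 * (4 + 6 * mu4 / v) / (12 * v ^+ 2) + 8 * a ^+ 6 / (45 * v ^+ 3) + 2 / v.

Lemma quartic_rate_ge0 v mu4 a : 0 < v -> 0 <= mu4 -> 0 <= quartic_rate v mu4 a.
Proof.
move=> v0 m0; have v1 := ltW v0.
have a4 : 0 <= a ^+ 4 by rewrite exprn_even_ge0.
have a6 : 0 <= a ^+ 6 by rewrite exprn_even_ge0.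
apply: addr_ge0; last by rewrite divr_ge0.
apply: addr_ge0.
  apply: divr_ge0; last by rewrite mulr_ge0 ?exprn_ge0.
  by apply: mulr_ge0 => //; apply: addr_ge0 => //; apply: divr_ge0 => //; apply: mulr_ge0.
by apply: divr_ge0; rewrite mulr_ge0// exprn_ge0.
Qed.

(** The inverse powers of t are bounded because t >= v / 2; everything is then
linear in the deviations of V and t and in W / r. *)
Lemma ler_dist_quartic (v mu4 V W t a r G : R) :
  0 < v -> 0 <= mu4 -> 0 <= V -> 0 <= W -> v / 2 <= t -> 0 < r -> 0 <= G ->
  a ^+ 4 * V / (12 * t ^+ 2) - a ^+ 6 * W / (45 * r * t ^+ 3) <= G ->
  G <= a ^+ 4 * V / (12 * t ^+ 2) ->
  `|expR (- G) - expR (- (mu4 / (12 * v ^+ 2) * a ^+ 4))| <=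
    quartic_rate v mu4 a * (`|V - mu4| + `|t - v| + W / r).
Proof.
move=> v0 m0 V0 W0 vt r0 G0 Gl Gu.
have t0 : 0 < t by apply: lt_le_trans vt; rewrite divr_gt0.
have a4 : 0 <= a ^+ 4 by rewrite exprn_even_ge0.
have a6 : 0 <= a ^+ 6 by rewrite exprn_even_ge0.
apply: (le_trans (ler_dist_expRN G0 _)).
  by rewrite mulr_ge0// divr_ge0// mulr_ge0// exprn_ge0// ltW.
have tV : t^-1 <= 2 / v.
  by rewrite -[2 / v]invrK invf_div lef_pV2// posrE divr_gt0.
have tV0 : 0 <= t^-1 by rewrite invr_ge0 ltW.
have vV0 : 0 <= 2 / v by rewrite divr_ge0// ltW.
have tV2 : t ^- 2 <= 4 / v ^+ 2.
  rewrite -exprVn; have -> : 4 / v ^+ 2 = (2 / v) ^+ 2 by field; rewrite gt_eqF.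
  by rewrite lerXn2r.
have tV3 : t ^- 3 <= 8 / v ^+ 3.
  rewrite -exprVn; have -> : 8 / v ^+ 3 = (2 / v) ^+ 3 by field; rewrite gt_eqF.
  by rewrite lerXn2r.
have main : `|V / t ^+ 2 - mu4 / v ^+ 2| <=
    4 / v ^+ 2 * `|V - mu4| + 6 * mu4 / v ^+ 3 * `|t - v|.
  have -> : V / t ^+ 2 - mu4 / v ^+ 2 =
     t ^- 2 * (V - mu4) + mu4 / v ^+ 2 * ((1 + v / t) / t) * (v - t).
    by field; rewrite !gt_eqF.
  apply: (le_trans (ler_normD _ _)).
  rewrite (normrM (t ^- 2)) (normrM (mu4 / v ^+ 2 * _)) (normrM (mu4 / v ^+ 2)).
  apply: lerD.
    by rewrite ler_wpM2r// ger0_norm// invr_ge0 exprn_ge0// ltW.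
  rewrite distrC ler_wpM2r//.
  have h0 : 0 <= (1 + v / t) / t.
    by rewrite divr_ge0 ?addr_ge0// ?divr_ge0// ltW.
  rewrite (ger0_norm h0) ger0_norm//; last by rewrite divr_ge0// exprn_ge0// ltW.
  have h1 : v / t <= 2 by rewrite ler_pdivrMr//; lra.
  have h2 : (1 + v / t) / t <= 6 / v.
    apply: (@le_trans _ _ (3 / t)); first by rewrite ler_wpM2r//; lra.
    have -> : 6 / v = 3 * (2 / v) by field; rewrite gt_eqF.
    by rewrite ler_wpM2l.
  have -> : 6 * mu4 / v ^+ 3 = mu4 / v ^+ 2 * (6 / v) by field; rewrite gt_eqF.
  by rewrite ler_wpM2l// divr_ge0// exprn_ge0// ltW.
have B1 : a ^+ 6 * W / (45 * r * t ^+ 3) <= 8 * a ^+ 6 / (45 * v ^+ 3) * (W / r).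
  have -> : a ^+ 6 * W / (45 * r * t ^+ 3) = a ^+ 6 / 45 * (W / r) * t ^- 3.
    by field; rewrite !gt_eqF.
  have -> : 8 * a ^+ 6 / (45 * v ^+ 3) * (W / r) = a ^+ 6 / 45 * (W / r) * (8 / v ^+ 3).
    by field; rewrite !gt_eqF.
  by rewrite ler_wpM2l// mulr_ge0 ?divr_ge0// ltW.
have eA : a ^+ 4 * V / (12 * t ^+ 2) - mu4 / (12 * v ^+ 2) * a ^+ 4 =
   a ^+ 4 / 12 * (V / t ^+ 2 - mu4 / v ^+ 2) by field; rewrite !gt_eqF.
have A1 : `|a ^+ 4 * V / (12 * t ^+ 2) - mu4 / (12 * v ^+ 2) * a ^+ 4| <=
   a ^+ 4 / 12 * (4 / v ^+ 2 * `|V - mu4| + 6 * mu4 / v ^+ 3 * `|t - v|).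
  by rewrite eA normrM ger0_norm ?divr_ge0// ler_wpM2l// divr_ge0.
have step : `|G - mu4 / (12 * v ^+ 2) * a ^+ 4| <=
   `|a ^+ 4 * V / (12 * t ^+ 2) - mu4 / (12 * v ^+ 2) * a ^+ 4| +
   a ^+ 6 * W / (45 * r * t ^+ 3).
  have w0 : 0 <= a ^+ 6 * W / (45 * r * t ^+ 3).
    apply: divr_ge0; first exact: mulr_ge0.
    by rewrite ltW// mulr_gt0 ?exprn_gt0// mulr_gt0.
  move: Gl Gu w0; set A := a ^+ 4 * V / _; set B := a ^+ 6 * W / _.
  set m := mu4 / _ * _ => Gl Gu w0.
  have -> : G - m = (A - m) + (G - A) by ring.
  apply: (le_trans (ler_normD _ _)); rewrite lerD2l.
  by rewrite ler0_norm ?subr_le0// opprB; lra.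
apply: (le_trans step); apply: (le_trans (lerD A1 B1)).
have -> : a ^+ 4 / 12 * (4 / v ^+ 2 * `|V - mu4| + 6 * mu4 / v ^+ 3 * `|t - v|) =
  (a ^+ 4 * 4 / (12 * v ^+ 2)) * `|V - mu4| +
  (a ^+ 4 * (6 * mu4 / v) / (12 * v ^+ 2)) * `|t - v|.
  by field; rewrite gt_eqF.
rewrite /quartic_rate.
have v2 : 0 <= 12 * v ^+ 2 by rewrite mulr_ge0// exprn_ge0// ltW.
have v3 : 0 <= 45 * v ^+ 3 by rewrite mulr_ge0// exprn_ge0// ltW.
set p := a ^+ 4 * 4 / (12 * v ^+ 2).
set p' := a ^+ 4 * (6 * mu4 / v) / (12 * v ^+ 2).
set p'' := 8 * a ^+ 6 / (45 * v ^+ 3).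
have -> : a ^+ 4 * (4 + 6 * mu4 / v) / (12 * v ^+ 2) = p + p'.
  by rewrite /p /p' -mulrDl -mulrDr.
have p0 : 0 <= p by rewrite /p divr_ge0// mulr_ge0.
have p'0 : 0 <= p' by rewrite /p' divr_ge0// mulr_ge0// divr_ge0 ?mulr_ge0// ltW.
have p''0 : 0 <= p'' by rewrite /p'' divr_ge0// mulr_ge0.
have v4 : 0 <= 2 / v by [].
have n1 := normr_ge0 (V - mu4); have n2 := normr_ge0 (t - v).
have n3 : 0 <= W / r by rewrite divr_ge0// ltW.
rewrite !mulrDr !mulrDl.
rewrite -subr_ge0.
set X := (X in 0 <= X).
have -> : X = p' * `|V - mu4| + p'' * `|V - mu4| + 2 / v * `|V - mu4| + p * `|t - v| +
   p'' * `|t - v| + 2 / v * `|t - v| + p * (W / r) + p' * (W / r) + 2 / v * (W / r).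
  by rewrite /X; ring.
by rewrite !addr_ge0// mulr_ge0.
Qed.

End pointwise.

Section tilted.
Context {R : realType}.
Implicit Types (a q : R).

(** The numbers y_i: unless x = 0, their squares add up to (q a)^2. *)
Definition tilt n (q a : R) (x : n.-tuple R) (i : 'I_n) : R :=
  q * a / Num.sqrt (tsum_sq x) * tnth x i.

Definition tmean (g : R -> R) n (x : n.-tuple R) : R := tsumf g x / n%:R.

Definition gap_sum n (q a : R) (x : n.-tuple R) : R :=
  \sum_(i < n) cosh_gap (tilt q a x i).

Lemma gap_sum_ge0 n q a (x : n.-tuple R) : 0 <= gap_sum q a x.
Proof. by apply: sumr_ge0 => i _; exact: cosh_gap_ge0. Qed.

Lemma sum_tiltX n q a (x : n.-tuple R) k : 0 < tsum_sq x ->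
  \sum_(i < n) tilt q a x i ^+ k.*2 =
    (q * a) ^+ k.*2 / tsum_sq x ^+ k * tsumf (fun z => z ^+ k.*2) x.
Proof.
move=> T0; rewrite /tsumf mulr_sumr; apply: eq_bigr => i _.
rewrite /tilt exprMn expr_div_n; congr (_ / _ * _).
by rewrite -[in LHS]mul2n exprM sqr_sqrtr// ltW.
Qed.

(** The cancellation on which the theorem rests: the squares of the tilts add up to
(q a)^2 for every nonzero sample, so the Gaussian factor disappears. *)
Lemma prod_cosh_tilt n q a (x : n.-tuple R) : 0 < tsum_sq x ->
  expR (- ((q * a) ^+ 2 / 2)) * \prod_(i < n) cosh (q * a / Num.sqrt (tsum_sq x) * tnth x i) =
  expR (- gap_sum q a x).
Proof.
move=> T0; under eq_bigr => i _ do rewrite expR_cosh_gap.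
rewrite -expR_sum -expRD; congr expR.
rewrite big_split/= sumrN -/(gap_sum q a x) -mulr_suml.
rewrite (sum_tiltX q a 1 T0) expr1 -tsum_sqE divfK ?gt_eqF//.
by rewrite addrA addNr add0r.
Qed.

(** Sums the tangent bound with l = q^-2, the value of y_i^2 when all the x_i are equal and
a = 1. *)
Lemma gap_sum_ge n q a (x : n.-tuple R) : 1 <= q -> q ^+ 4 = n%:R ->
  0 < tsum_sq x -> (a ^+ 2 - 1) / 24 <= gap_sum q a x.
Proof.
move=> q1 qn T0; have q0 : 0 < q by exact: lt_le_trans q1.
apply: (@le_trans _ _ (\sum_(i < n)
    (2 * q ^- 2 * tilt q a x i ^+ 2 - (q ^- 2) ^+ 2 * (1 + tilt q a x i ^+ 2)) / 24)).
  rewrite -mulr_suml ler_wpM2r// sumrB -!mulr_sumr big_split/= sumr_const card_ord.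
  rewrite (sum_tiltX q a 1 T0) expr1 -tsum_sqE divfK ?gt_eqF//.
  rewrite -[1 *+ n]/(n%:R) -qn.
  have -> : 2 * q ^- 2 * (q * a) ^+ 1.*2 - q ^- 2 ^+ 2 * (q ^+ 4 + (q * a) ^+ 1.*2) =
     2 * a ^+ 2 - 1 - a ^+ 2 / q ^+ 2.
    by rewrite -[1.*2]/2%N; field; rewrite gt_eqF.
  have : a ^+ 2 / q ^+ 2 <= a ^+ 2.
    rewrite ler_pdivrMr ?exprn_gt0// ler_peMr ?sqr_ge0//.
    by rewrite expr_ge1// ltW.
  lra.
by apply: ler_sum => i _; exact: cosh_gap_ge_tangent.
Qed.

Lemma gap_sum_quartic n q a (x : n.-tuple R) : q != 0 -> q ^+ 4 = n%:R ->
  0 < tsum_sq x ->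
  a ^+ 4 * tmean (fun z => z ^+ 4) x / (12 * tmean (fun z => z ^+ 2) x ^+ 2)
    - a ^+ 6 * tmean (fun z => z ^+ 6) x
      / (45 * q ^+ 2 * tmean (fun z => z ^+ 2) x ^+ 3)
    <= gap_sum q a x <=
  a ^+ 4 * tmean (fun z => z ^+ 4) x / (12 * tmean (fun z => z ^+ 2) x ^+ 2).
Proof.
move=> q0 qn T0; rewrite /tmean -tsum_sqE.
set V := tsumf (fun z => z ^+ 4) x / n%:R.
set W := tsumf (fun z => z ^+ 6) x / n%:R.
set t := tsum_sq x / n%:R.
have TN0 : tsum_sq x != 0 by rewrite gt_eqF.
have e4 : \sum_(i < n) tilt q a x i ^+ 4 / 12 = a ^+ 4 * V / (12 * t ^+ 2).
  rewrite -mulr_suml (sum_tiltX q a 2 T0) /V /t -qn -[2.*2]/4%N.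
  by field; rewrite q0.
have e6 : \sum_(i < n) tilt q a x i ^+ 6 / 45 = a ^+ 6 * W / (45 * q ^+ 2 * t ^+ 3).
  rewrite -mulr_suml (sum_tiltX q a 3 T0) /W /t -qn -[3.*2]/6%N.
  by field; rewrite q0.
apply/andP; split.
  by rewrite -e4 -e6 -sumrB; apply: ler_sum => i _; exact: cosh_gap_ge.
by rewrite -e4; apply: ler_sum => i _; exact: cosh_gap_le.
Qed.

(** When the empirical variance is at least v / 2 this is [ler_dist_quartic]. Otherwise the
left side is at most 1, and 1 <= 2 / v * |t - v|. *)
Lemma gap_sum_dist n q a v mu4 (x : n.-tuple R) :
  0 < v -> 0 <= mu4 -> 1 <= q -> q ^+ 4 = n%:R ->
  `|expR (- gap_sum q a x) * \1_[set y | 0 < tsum_sq y] x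
     - expR (- (mu4 / (12 * v ^+ 2) * a ^+ 4))| <=
    quartic_rate v mu4 a * (`|tmean (fun z => z ^+ 4) x - mu4| +
      `|tmean (fun z => z ^+ 2) x - v| + tmean (fun z => z ^+ 6) x / q ^+ 2).
Proof.
move=> v0 m0 q1 qn.
set V := tmean (fun z => z ^+ 4) x; set W := tmean (fun z => z ^+ 6) x.
set t := tmean (fun z => z ^+ 2) x.
have q0 : 0 < q by exact: lt_le_trans q1.
have V0 : 0 <= V by rewrite divr_ge0// sumr_ge0// => i _; rewrite exprn_even_ge0.
have W0 : 0 <= W by rewrite divr_ge0// sumr_ge0// => i _; rewrite exprn_even_ge0.
have [vt|tv] := leP (v / 2) t.
  have T0 : 0 < tsum_sq x.
    have t0 : 0 < t by apply: lt_le_trans vt; rewrite divr_gt0.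
    move: t0; rewrite /t /tmean -tsum_sqE; have [->|n0] := eqVneq (n%:R : R) 0.
      by rewrite invr0 mulr0 ltxx.
    by rewrite pmulr_lgt0// invr_gt0 lt_neqAle eq_sym n0/=.
  rewrite indicE mem_set// mulr1.
  have /andP[l u] := gap_sum_quartic a (lt0r_neq0 q0) qn T0.
  by apply: ler_dist_quartic => //; rewrite ?exprn_gt0 ?gap_sum_ge0.
have le1 (b b' : R) : 0 <= b <= 1 -> 0 <= b' <= 1 -> `|b - b'| <= 1.
  by move=> *; rewrite ler_norml; apply/andP; split; lra.
apply: (@le_trans _ _ 1).
  apply: le1.
    apply/andP; split; first by rewrite mulr_ge0// expR_ge0.
    apply: (@le_trans _ _ (expR (- gap_sum q a x))).
      by rewrite ler_piMr ?expR_ge0// indicE; case: (_ \in _).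
    by rewrite -expR0 ler_expR oppr_le0 gap_sum_ge0.
  rewrite expR_ge0/= -expR0 ler_expR oppr_le0.
  by rewrite mulr_ge0 ?exprn_even_ge0// divr_ge0// mulr_ge0 ?exprn_ge0// ltW.
apply: (@le_trans _ _ (2 / v * (v / 2))).
  by have -> : 2 / v * (v / 2) = 1 by field; rewrite gt_eqF.
apply: ler_pM.
- by rewrite divr_ge0// ltW.
- by rewrite divr_ge0// ltW.
- rewrite /quartic_rate lerDr; have vl := ltW v0.
  have a4 : 0 <= a ^+ 4 by rewrite exprn_even_ge0.
  have a6 : 0 <= a ^+ 6 by rewrite exprn_even_ge0.
  apply: addr_ge0; apply: divr_ge0.
  - by apply: mulr_ge0 => //; apply: addr_ge0 => //; apply: divr_ge0 => //; apply: mulr_ge0.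
  - by rewrite mulr_ge0// exprn_ge0.
  - exact: mulr_ge0.
  - by rewrite mulr_ge0// exprn_ge0.
- apply: (@le_trans _ _ `|t - v|).
    by rewrite distrC; apply: le_trans (ler_norm _); lra.
  by rewrite -addrA addrCA lerDl addr_ge0// divr_ge0// exprn_ge0// ltW.
Qed.

End tilted.

Lemma integralZ_EFin d (T : measurableType d) (R : realType)
    (mu : {measure set T -> \bar R}) (k : R) (f : T -> R) :
  measurable_fun setT f -> (forall x, 0 <= f x) -> 0 <= k ->
  (\int[mu]_x (k * f x)%:E = k%:E * \int[mu]_x (f x)%:E)%E.
Proof.
move=> mf f0 k0; under eq_integral do rewrite EFinM.
rewrite ge0_integralZl//; first exact/measurable_EFinP.
by move=> x _; rewrite lee_fin.
Qed.

(** * Gaussian integrals and the Hubbard-Stratonovich kernel *)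

Section gauss.
Context {R : realType}.
Local Notation leb := (@lebesgue_measure R).

Definition gauss_mass : R := Num.sqrt (pi *+ 2).

Lemma gauss_mass_gt0 : 0 < gauss_mass.
Proof. by rewrite sqrtr_gt0 pmulrn_lgt0// pi_gt0. Qed.

Lemma measurable_gauss (k m : R) :
  measurable_fun setT (fun s : R => expR (- ((k * (s - m)) ^+ 2 / 2))).
Proof.
apply: measurableT_comp => //; apply: measurableT_comp => //.
apply: measurable_funM => //; apply: measurable_funX.
by apply: measurable_funM => //; exact: measurable_funB.
Qed.

Lemma integral_gauss (k m : R) : 0 < k ->
  (\int[leb]_s (expR (- ((k * (s - m)) ^+ 2 / 2)))%:E = (gauss_mass / k)%:E)%E.
Proof.
move=> k0; have kV0 : k^-1 != 0 by rewrite invr_neq0// gt_eqF.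
have pk0 := normal_peak_gt0 kV0.
transitivity (\int[leb]_s ((normal_peak k^-1)^-1%:E * (normal_pdf m k^-1 s)%:E))%E.
  apply: eq_integral => s _.
  rewrite -EFinM (normal_pdfE _ kV0) mulrA mulVf ?gt_eqF// mul1r /normal_fun.
  by congr (expR _)%:E; field; rewrite gt_eqF.
rewrite ge0_integralZl//=; last 3 first.
- by apply/measurable_EFinP; exact: measurable_normal_pdf.
- by move=> s _; rewrite lee_fin normal_pdf_ge0.
- by rewrite lee_fin invr_ge0 ltW.
rewrite integral_normal_pdf mule1; congr (_%:E).
rewrite /normal_peak invrK /gauss_mass -mulrnAr sqrtrM ?sqr_ge0// sqrtr_sqr.
by rewrite ger0_norm ?invr_ge0 ?(ltW k0)// mulrC.
Qed.

(** Only the order k^-3 matters: u^2 <= 4 exp (3 / 8 u^2) trades the square for a wider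
Gaussian, so that the total mass suffices. *)
Lemma integral_gauss_sqr (k m : R) : 0 < k ->
  (\int[leb]_s ((s - m) ^+ 2 * expR (- ((k * (s - m)) ^+ 2 / 2)))%:E <=
     (8 / k ^+ 2 * (gauss_mass / k))%:E)%E.
Proof.
move=> k0; have k2 : 0 < k / 2 by rewrite divr_gt0.
apply: (@le_trans _ _ (\int[leb]_s ((4 / k ^+ 2)%:E *
    (expR (- ((k / 2 * (s - m)) ^+ 2 / 2)))%:E))%E).
  apply: ge0_le_integral => //.
  - by move=> s _; rewrite lee_fin mulr_ge0 ?sqr_ge0// expR_ge0.
  - apply/measurable_EFinP/measurable_funM; last exact: measurable_gauss.
    by apply: measurable_funX; exact: measurable_funB.
  - by apply: emeasurable_funM => //; apply/measurable_EFinP; exact: measurable_gauss.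
  - move=> s _; rewrite -EFinM lee_fin.
    set u := s - m.
    have -> : 4 / k ^+ 2 * expR (- ((k / 2 * u) ^+ 2 / 2)) =
       4 / k ^+ 2 * expR (3 / 8 * (k * u) ^+ 2) * expR (- ((k * u) ^+ 2 / 2)).
      by rewrite -[RHS]mulrA -expRD; congr (_ * expR _); field.
    rewrite ler_wpM2r ?expR_ge0// mulrAC ler_pdivlMr ?exprn_gt0//.
    have := expR_ge1Dx (3 / 8 * (k * u) ^+ 2).
    have := sqr_ge0 (k * u); rewrite exprMn; lra.
rewrite ge0_integralZl//=; last 2 first.
- by apply/measurable_EFinP; exact: measurable_gauss.
- by rewrite lee_fin divr_ge0// sqr_ge0.
rewrite integral_gauss// -EFinM lee_fin le_eqVlt; apply/orP; left; apply/eqP.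
by field; rewrite gt_eqF.
Qed.

Lemma measurable_inv_sqrt : measurable_fun setT (fun t : R => (Num.sqrt t)^-1).
Proof.
have -> : (fun t : R => (Num.sqrt t)^-1) = (fun t => (Num.sqrt t) `^ (-1)).
  by apply/funext => t; rewrite powR_inv1// sqrtr_ge0.
apply: (measurableT_comp (measurable_powR (-1))).
exact: continuous_measurable_fun (@sqrt_continuous R).
Qed.

End gauss.

Section kernel.
Context (R : realType) (rho : probability R R).
Hypothesis rho_sym : symmetric_measure rho.
Local Notation leb := (@lebesgue_measure R).
Variables (sigma q : R) (n : nat).
Local Notation mun := (power_prob rho n).
Implicit Types (x : n.-tuple R) (s : R).

(** The indicator of nondegenerate samples, as a function of the sum of squares only: this
is the form to which the averaging over signs applies. *)
Definition supp_ind (t : R) : R := \1_[set t | 0 < t] t.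

(** The Hubbard-Stratonovich integrand exp (g b - g^2 / 2) at g = q s / sigma, where q
stands for n^(1/4). In this scale s has the size of S / n^(3/4). *)
Definition hs_kernel x s : R :=
  expR (- ((q * (s / sigma)) ^+ 2 / 2) +
        q * (s / sigma) / Num.sqrt (tsum_sq x) * tsum x) * supp_ind (tsum_sq x).

(** What becomes of [hs_kernel] after averaging over the signs of the x_i. *)
Definition gap_density x s : R :=
  expR (- gap_sum q (s / sigma) x) * supp_ind (tsum_sq x).

(** A Gaussian, so that its mass and its second moment come from the Gaussian integrals. *)
Definition hs_dominant s : R := expR 24^-1 * expR (- (((4 * sigma)^-1 * (s - 0)) ^+ 2 / 2)).

Lemma supp_ind_ge0 t : 0 <= supp_ind t.
Proof. by rewrite /supp_ind indicE. Qed.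

Lemma measurable_supp_ind : measurable_fun setT supp_ind.
Proof.
apply: measurable_indic.
have -> : [set t : R | 0 < t] = `]0, +oo[%classic.
  by apply/seteqP; split => t /=; rewrite in_itv/= andbT.
exact: measurable_itv.
Qed.

Lemma hs_kernel_ge0 x s : 0 <= hs_kernel x s.
Proof. by rewrite mulr_ge0 ?expR_ge0 ?supp_ind_ge0. Qed.

Lemma gap_density_ge0 x s : 0 <= gap_density x s.
Proof. by rewrite mulr_ge0 ?expR_ge0 ?supp_ind_ge0. Qed.

Lemma hs_dominant_ge0 s : 0 <= hs_dominant s.
Proof. by rewrite mulr_ge0 ?expR_ge0. Qed.

Lemma measurable_tsum_sq1 : measurable_fun setT (fun p : n.-tuple R * R => tsum_sq p.1).
Proof. exact: (measurableT_comp (@measurable_tsum_sq R n) measurable_fst). Qed.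

Lemma measurable_kernel_arg :
  measurable_fun setT (fun p : n.-tuple R * R =>
    q * (p.2 / sigma) / Num.sqrt (tsum_sq p.1)).
Proof.
apply: measurable_funM.
  by apply: measurable_funM => //; exact: measurable_funM.
exact: (measurableT_comp measurable_inv_sqrt measurable_tsum_sq1).
Qed.

Lemma measurable_hs_kernel :
  measurable_fun setT (fun p : n.-tuple R * R => hs_kernel p.1 p.2).
Proof.
apply: measurable_funM; last first.
  exact: (measurableT_comp measurable_supp_ind measurable_tsum_sq1).
apply: measurableT_comp => //; apply: measurable_funD.
  apply: measurableT_comp => //; apply: measurable_funM => //.
  by apply: measurable_funX; apply: measurable_funM => //; exact: measurable_funM.
apply: measurable_funM; first exact: measurable_kernel_arg.
exact: (measurableT_comp (@measurable_tsum R n) measurable_fst).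
Qed.

Lemma measurable_gap_density :
  measurable_fun setT (fun p : n.-tuple R * R => gap_density p.1 p.2).
Proof.
apply: measurable_funM; last first.
  exact: (measurableT_comp measurable_supp_ind measurable_tsum_sq1).
apply: measurableT_comp => //; apply: measurableT_comp => //.
apply: measurable_sum => i.
have mcg : measurable_fun setT (@cosh_gap R).
  apply: measurable_funB; first by apply: measurable_funM => //; exact: exprn_measurable.
  by apply: measurableT_comp => //; exact: measurable_cosh.
apply: measurableT_comp => //; apply: measurable_funM; first exact: measurable_kernel_arg.
exact: (measurableT_comp (measurable_tnth i) measurable_fst).
Qed.

(** Holds for each fixed s: with the other factors depending on the sum of squares only,
the averaging over signs turns the kernel into the product of the cosh of the tilts. *)
Lemma integral_hs_kernel_symmetric s (ph : R -> R) :
  measurable_fun setT ph -> (forall t, 0 <= ph t) ->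
  (\int[mun]_x (ph (tsum_sq x) * hs_kernel x s)%:E =
   \int[mun]_x (ph (tsum_sq x) * gap_density x s)%:E)%E.
Proof.
move=> mph ph0.
pose th t := q * (s / sigma) / Num.sqrt t.
pose psi t := expR (- ((q * (s / sigma)) ^+ 2 / 2)) * supp_ind t * ph t.
have mth : measurable_fun setT th.
  by apply: measurable_funM => //; exact: measurable_inv_sqrt.
have mpsi : measurable_fun setT psi.
  by apply: measurable_funM => //; apply: measurable_funM => //; exact: measurable_supp_ind.
have psi0 t : 0 <= psi t by rewrite !mulr_ge0 ?expR_ge0 ?supp_ind_ge0.
have := integral_expR_tsum rho_sym n mth mpsi psi0.
rewrite /th /psi => h.
transitivity (\int[mun]_x
         (expR (q * (s / sigma) / Num.sqrt (tsum_sq x) * tsum x) *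
          (expR (- ((q * (s / sigma)) ^+ 2 / 2)) * supp_ind (tsum_sq x) * ph (tsum_sq x)))%:E)%E.
  by apply: eq_integral => x _; rewrite /hs_kernel expRD; congr (_%:E); ring.
rewrite h; apply: eq_integral => x _; congr (_%:E).
rewrite /gap_density /supp_ind indicE.
have [|T0] := boolP (tsum_sq x \in [set t | 0 < t]).
  rewrite inE /= => T0.
  by rewrite -(prod_cosh_tilt q (s / sigma) T0) !mulr1; ring.
by rewrite !(mulr0, mul0r).
Qed.

Hypotheses (sigma0 : 0 < sigma) (q1 : 1 <= q) (qn : q ^+ 4 = n%:R).

(** Weakening 1 / 24 to 1 / 32 gives the dominating Gaussian the standard deviation
4 sigma, free of square roots. *)
Lemma gap_density_le x s : gap_density x s <= hs_dominant s.
Proof.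
rewrite /gap_density /supp_ind indicE.
have [|_] := boolP (tsum_sq x \in [set t | 0 < t]); last by rewrite mulr0 hs_dominant_ge0.
rewrite inE /= => T0; rewrite mulr1 /hs_dominant -expRD ler_expR.
have := gap_sum_ge (s / sigma) q1 qn T0.
have -> : - (((4 * sigma)^-1 * (s - 0)) ^+ 2 / 2) = - ((s / sigma) ^+ 2 / 32).
  by field; rewrite gt_eqF.
have := sqr_ge0 (s / sigma); lra.
Qed.

Lemma measurable_hs_dominant : measurable_fun setT hs_dominant.
Proof.
apply: measurable_funM => //.
exact: measurable_gauss.
Qed.

End kernel.

Section dominant.
Context (R : realType) (sigma : R).
Hypothesis sigma0 : 0 < sigma.
Local Notation leb := (@lebesgue_measure R).

Definition dominant_mass : R := expR 24^-1 * (gauss_mass * (4 * sigma)).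
Definition dominant_moment : R := dominant_mass * (128 * sigma ^+ 2).

Lemma dominant_mass_ge0 : 0 <= dominant_mass.
Proof.
by rewrite mulr_ge0 ?expR_ge0// mulr_ge0 ?(ltW gauss_mass_gt0)// mulr_ge0// ltW.
Qed.

Lemma integral_hs_dominant :
  (\int[leb]_s (hs_dominant sigma s)%:E = dominant_mass%:E)%E.
Proof.
have k0 : 0 < (4 * sigma)^-1 by rewrite invr_gt0 mulr_gt0.
rewrite integralZ_EFin; last 3 first.
- exact: measurable_gauss.
- by move=> s; exact: expR_ge0.
- exact: expR_ge0.
by rewrite integral_gauss// -EFinM invrK.
Qed.

Lemma integral_hs_dominant_sqr :
  (\int[leb]_s (s ^+ 2 * hs_dominant sigma s)%:E <= dominant_moment%:E)%E.
Proof.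
have k0 : 0 < (4 * sigma)^-1 by rewrite invr_gt0 mulr_gt0.
have h := integral_gauss_sqr 0 k0.
have e (s : R) : s ^+ 2 * hs_dominant sigma s =
    expR 24^-1 * ((s - 0) ^+ 2 * expR (- (((4 * sigma)^-1 * (s - 0)) ^+ 2 / 2))).
  by rewrite /hs_dominant subr0 mulrCA.
under eq_integral do rewrite e.
rewrite integralZ_EFin; last 3 first.
- apply: measurable_funM; last exact: measurable_gauss.
  by apply: measurable_funX; exact: measurable_funB.
- by move=> s; rewrite mulr_ge0 ?sqr_ge0// expR_ge0.
- exact: expR_ge0.
apply: (@le_trans _ _ ((expR 24^-1)%:E *
   (8 / (4 * sigma)^-1 ^+ 2 * (gauss_mass / (4 * sigma)^-1))%:E)%E).
  by apply: lee_wpmul2l => //; rewrite lee_fin expR_ge0.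
rewrite -EFinM lee_fin le_eqVlt; apply/orP; left; apply/eqP.
by rewrite /dominant_moment /dominant_mass; field; rewrite gt_eqF.
Qed.

End dominant.

Section joint.
Context (R : realType) (rho : probability R R).
Hypothesis rho_sym : symmetric_measure rho.
Local Notation leb := (@lebesgue_measure R).
Variables (sigma q : R) (n : nat).
Hypotheses (sigma0 : 0 < sigma) (q1 : 1 <= q) (qn : q ^+ 4 = n%:R).
Local Notation mun := (power_prob rho n).
Local Notation joint := (mun \x leb)%E.
Local Notation kern := (hs_kernel sigma q).
Implicit Types (x : n.-tuple R) (s : R).

Let q0 : 0 < q. Proof. exact: lt_le_trans q1. Qed.

(** The mean of s under the kernel, which is Gaussian in s for a fixed sample. *)
Definition hs_mean x : R := tsum x / Num.sqrt (tsum_sq x) / (q / sigma).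

(** Completing the square. *)
Lemma hs_kernelE x s : hs_kernel sigma q x s =
  weight x * expR (- ((q / sigma * (s - hs_mean x)) ^+ 2 / 2)).
Proof.
rewrite /hs_kernel /weight /supp_ind !indicE.
have -> : (x \in [set y : n.-tuple R | 0 < tsum_sq y]) = (tsum_sq x \in [set t | 0 < t]).
  by apply/idP/idP; rewrite !inE.
have [|_] := boolP (tsum_sq x \in [set t | 0 < t]); last by rewrite !mulr0 mul0r.
rewrite inE /= => T0; rewrite !mulr1 -expRD; congr expR.
have -> : tsum x ^+ 2 / tsum_sq x = (tsum x / Num.sqrt (tsum_sq x)) ^+ 2.
  by rewrite expr_div_n sqr_sqrtr// ltW.
have r0 : Num.sqrt (tsum_sq x) != 0 by rewrite gt_eqF// sqrtr_gt0.
by rewrite /hs_mean; field; rewrite r0 !gt_eqF.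
Qed.

Lemma weight_ge0 x : 0 <= weight x.
Proof. by rewrite mulr_ge0 ?expR_ge0// indicE. Qed.

Lemma measurable_weight : measurable_fun setT (@weight R n).
Proof.
have -> : @weight R n = (fun x => expR (2^-1 * (tsum x / Num.sqrt (tsum_sq x)) ^+ 2)
     * supp_ind (tsum_sq x)).
  apply/funext => x; rewrite /weight /supp_ind !indicE.
  have -> : (x \in [set y : n.-tuple R | 0 < tsum_sq y]) = (tsum_sq x \in [set t | 0 < t]).
    by apply/idP/idP; rewrite !inE.
  have [|_] := boolP (tsum_sq x \in [set t | 0 < t]); last by rewrite !mulr0.
  by rewrite inE /= => T0; rewrite expr_div_n sqr_sqrtr// ltW.
apply: measurable_funM; last first.
  by apply: measurableT_comp; [exact: measurable_supp_ind | exact: measurable_tsum_sq].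
apply: measurableT_comp => //; apply: measurable_funM => //.
apply: measurable_funX; apply: measurable_funM; first exact: measurable_tsum.
exact: (measurableT_comp measurable_inv_sqrt (@measurable_tsum_sq R n)).
Qed.

Definition hs_mass : R := gauss_mass / (q / sigma).

Lemma hs_mass_gt0 : 0 < hs_mass.
Proof. by rewrite divr_gt0 ?gauss_mass_gt0// divr_gt0. Qed.

Lemma integral_hs_kernel x :
  (\int[leb]_s (kern x s)%:E = (hs_mass * weight x)%:E)%E.
Proof.
have k0 : 0 < q / sigma by rewrite divr_gt0.
under eq_integral do rewrite hs_kernelE.
rewrite integralZ_EFin; last 3 first.
- exact: measurable_gauss.
- by move=> s; exact: expR_ge0.
- exact: weight_ge0.
by rewrite integral_gauss// -EFinM mulrC.
Qed.

Lemma integral_hs_kernel_sqr x :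
  (\int[leb]_s ((s - hs_mean x) ^+ 2 * kern x s)%:E <=
     (8 / (q / sigma) ^+ 2 * (hs_mass * weight x))%:E)%E.
Proof.
have k0 : 0 < q / sigma by rewrite divr_gt0.
under eq_integral do rewrite hs_kernelE mulrCA.
rewrite integralZ_EFin; last 3 first.
- apply: measurable_funM; last exact: measurable_gauss.
  by apply: measurable_funX; exact: measurable_funB.
- by move=> s; rewrite mulr_ge0 ?sqr_ge0// expR_ge0.
- exact: weight_ge0.
apply: (@le_trans _ _ ((weight x)%:E * (8 / (q / sigma) ^+ 2 * hs_mass)%:E)%E).
  apply: lee_wpmul2l; first by rewrite lee_fin weight_ge0.
  exact: integral_gauss_sqr.
by rewrite -EFinM lee_fin mulrCA [weight x * _]mulrC.
Qed.

Lemma integral_joint_fst (ph : n.-tuple R -> R) :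
  measurable_fun setT ph -> (forall x, 0 <= ph x) ->
  (\int[joint]_p (ph p.1 * kern p.1 p.2)%:E =
   \int[mun]_x (ph x * (hs_mass * weight x))%:E)%E.
Proof.
move=> mph ph0.
rewrite fubini_tonelli1//; last 2 first.
- apply/measurable_EFinP/measurable_funM; last exact: measurable_hs_kernel.
  exact: (measurableT_comp mph measurable_fst).
- by move=> p; rewrite lee_fin mulr_ge0 ?hs_kernel_ge0.
apply: eq_integral => x _; rewrite /fubini_F/=.
rewrite integralZ_EFin; last 3 first.
- exact: (measurableT_comp (@measurable_hs_kernel R sigma q n) (pair1_measurable x)).
- by move=> s; exact: hs_kernel_ge0.
- exact: ph0.
by rewrite integral_hs_kernel -EFinM.
Qed.

Lemma integral_joint_snd (w ph : R -> R) :
  measurable_fun setT w -> (forall s, 0 <= w s) ->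
  measurable_fun setT ph -> (forall t, 0 <= ph t) ->
  (\int[joint]_p (w p.2 * (ph (tsum_sq p.1) * kern p.1 p.2))%:E =
   \int[leb]_s ((w s)%:E * \int[mun]_x (ph (tsum_sq x) * gap_density sigma q x s)%:E))%E.
Proof.
move=> mw w0 mph ph0.
have mpk : measurable_fun setT (fun p : n.-tuple R * R => ph (tsum_sq p.1) * kern p.1 p.2).
  apply: measurable_funM; last exact: measurable_hs_kernel.
  exact: (measurableT_comp mph (@measurable_tsum_sq1 R n)).
rewrite fubini_tonelli2//; last 2 first.
- apply/measurable_EFinP/measurable_funM => //.
  exact: (measurableT_comp mw measurable_snd).
- by move=> p; rewrite lee_fin !mulr_ge0 ?hs_kernel_ge0.
apply: eq_integral => s _; rewrite /fubini_G/=.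
rewrite integralZ_EFin; last 3 first.
- exact: (measurableT_comp mpk (pair2_measurable s)).
- by move=> x; rewrite mulr_ge0 ?hs_kernel_ge0.
- exact: w0.
by rewrite (integral_hs_kernel_symmetric rho_sym).
Qed.

(** The deterministic domination separates s from the sample, and the bound is a product. *)
Lemma integral_joint_le (w ph : R -> R) (Kw Kph : R) :
  measurable_fun setT w -> (forall s, 0 <= w s) ->
  measurable_fun setT ph -> (forall t, 0 <= ph t) ->
  0 <= Kph ->
  (\int[leb]_s (w s * hs_dominant sigma s)%:E <= Kw%:E)%E ->
  (\int[mun]_x (ph (tsum_sq x))%:E <= Kph%:E)%E ->
  (\int[joint]_p (w p.2 * (ph (tsum_sq p.1) * kern p.1 p.2))%:E <= (Kw * Kph)%:E)%E.
Proof.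
move=> mw w0 mph ph0 Kph0 hw hph; rewrite integral_joint_snd//.
have mphT : measurable_fun setT (fun x : n.-tuple R => ph (tsum_sq x)).
  by apply: measurableT_comp => //; exact: measurable_tsum_sq.
have mgap (s : R) : measurable_fun setT (fun x : n.-tuple R => gap_density sigma q x s).
  exact: (measurableT_comp (@measurable_gap_density R sigma q n) (pair2_measurable s)).
apply: (@le_trans _ _ (\int[leb]_s (Kph * (w s * hs_dominant sigma s))%:E)%E).
  apply: ge0_le_integral => //.
  - move=> s _; rewrite mule_ge0 ?lee_fin//; apply: integral_ge0 => x _.
    by rewrite lee_fin mulr_ge0 ?gap_density_ge0.
  - apply: emeasurable_funM; first exact/measurable_EFinP.
    apply: (measurable_fun_fubini_tonelli_G (fun p : n.-tuple R * R =>
      (ph (tsum_sq p.1) * gap_density sigma q p.1 p.2)%:E)).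
      apply/measurable_EFinP/measurable_funM; last exact: measurable_gap_density.
      exact: (measurableT_comp mph (@measurable_tsum_sq1 R n)).
    by move=> p; rewrite lee_fin mulr_ge0 ?gap_density_ge0.
  - apply/measurable_EFinP/measurable_funM => //; apply: measurable_funM => //.
    exact: measurable_hs_dominant.
  - move=> s _.
    rewrite mulrCA EFinM; apply: lee_wpmul2l; first by rewrite lee_fin.
    apply: (@le_trans _ _ (\int[mun]_x (hs_dominant sigma s * ph (tsum_sq x))%:E)%E).
      apply: ge0_le_integral => //.
      + by move=> x _; rewrite lee_fin mulr_ge0 ?gap_density_ge0.
      + by apply/measurable_EFinP/measurable_funM; [exact: mphT|exact: mgap].
      + by apply/measurable_EFinP/measurable_funM => //; exact: mphT.
      + move=> x _; rewrite lee_fin mulrC ler_wpM2r//.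
        exact: gap_density_le.
    rewrite integralZ_EFin; last 3 first.
    + exact: mphT.
    + by move=> x.
    + exact: hs_dominant_ge0.
    rewrite [X in (_ <= X%:E)%E]mulrC (EFinM (hs_dominant sigma s)); by apply: lee_wpmul2l => //; rewrite lee_fin hs_dominant_ge0.
rewrite integralZ_EFin; last 3 first.
- by apply: measurable_funM => //; exact: measurable_hs_dominant.
- by move=> s; rewrite mulr_ge0 ?hs_dominant_ge0.
- exact: Kph0.
by rewrite [X in (_ <= X%:E)%E]mulrC EFinM; apply: lee_wpmul2l; rewrite ?lee_fin.
Qed.

End joint.

(** * Exchanging the scaled sum with the Gaussian variable *)

Section means.
Context (R : realType) (rho : probability R R).
Variables (q : R) (n : nat).
Hypotheses (q1 : 1 <= q) (qn : q ^+ 4 = n%:R).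
Local Notation mun := (power_prob rho n).

Let q0 : 0 < q. Proof. exact: lt_le_trans q1. Qed.
Let n0 : 0 < n%:R :> R. Proof. by rewrite -qn exprn_gt0. Qed.

Lemma measurable_tmean (g : R -> R) : measurable_fun setT g -> measurable_fun setT (@tmean R g n).
Proof. by move=> mg; apply: measurable_funM => //; exact: measurable_tsumf. Qed.

Lemma integral_tmean (g : R -> R) m : measurable_fun setT g -> (forall z, 0 <= g z) ->
  (\int[rho]_z (g z)%:E = m%:E)%E ->
  (\int[mun]_x (tmean g x)%:E = m%:E)%E.
Proof.
move=> mg g0 gm; under eq_integral do rewrite /tmean mulrC.
rewrite integralZ_EFin; last 3 first.
- exact: measurable_tsumf.
- by move=> x; exact: sumr_ge0.
- by rewrite invr_ge0.
by rewrite (integral_tsumf n mg g0 gm) -EFinM mulKf// gt_eqF.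
Qed.

Lemma integral_tmean_centered_sqr (g : R -> R) m M : measurable_fun setT g ->
  (forall z, 0 <= g z) ->
  (\int[rho]_z (g z)%:E = m%:E)%E -> (\int[rho]_z (g z ^+ 2)%:E = M%:E)%E ->
  (\int[mun]_x ((tmean g x - m) ^+ 2)%:E <= (M / q ^+ 4)%:E)%E.
Proof.
move=> mg g0 gm gM.
have e (x : n.-tuple R) : (tmean g x - m) ^+ 2 = n%:R ^- 2 * (tsumf g x - n%:R * m) ^+ 2.
  by rewrite /tmean; field; rewrite gt_eqF.
under eq_integral do rewrite e.
rewrite integralZ_EFin; last 3 first.
- apply: measurable_funX; apply: measurable_funB => //; exact: measurable_tsumf.
- by move=> x; exact: sqr_ge0.
- by rewrite invr_ge0 sqr_ge0.
rewrite (integral_tsumf_centered_sqr n mg g0 gm gM) -EFinM lee_fin qn.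
have -> : n%:R ^- 2 * (n%:R * (M - m ^+ 2)) = (M - m ^+ 2) / n%:R.
  by field; rewrite gt_eqF.
by rewrite ler_wpM2r ?invr_ge0 ?(ltW n0)// lerBlDr lerDl sqr_ge0.
Qed.

(** Reduces to the variance by |u| <= q^2 u^2 + q^-2, where q^-2 = n^(-1/2) is the size of the
deviations. *)
Lemma integral_tmean_dist (g : R -> R) m M : measurable_fun setT g ->
  (forall z, 0 <= g z) ->
  (\int[rho]_z (g z)%:E = m%:E)%E -> (\int[rho]_z (g z ^+ 2)%:E = M%:E)%E ->
  (\int[mun]_x `|tmean g x - m|%:E <= ((M + 1) / q ^+ 2)%:E)%E.
Proof.
move=> mg g0 gm gM.
have mc : measurable_fun setT (fun x : n.-tuple R => tmean g x - m).
  by apply: measurable_funB => //; exact: measurable_tmean.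
have m2 : measurable_fun setT (fun x : n.-tuple R => ((tmean g x - m) ^+ 2)).
  exact: measurable_funX.
apply: (@le_trans _ _ (\int[mun]_x ((q ^+ 2 * (tmean g x - m) ^+ 2)%:E + (q ^- 2)%:E))%E).
  apply: ge0_le_integral => //.
  - by apply/measurable_EFinP; apply: measurableT_comp.
  - by apply: emeasurable_funD => //; apply/measurable_EFinP; exact: measurable_funM.
  - move=> x _; rewrite -EFinD lee_fin.
    set u := tmean g x - m.
    have h := sqr_ge0 (q * `|u| - q^-1).
    have e : (q * `|u| - q^-1) ^+ 2 = q ^+ 2 * u ^+ 2 + q ^- 2 - 2 * `|u|.
      by rewrite -(real_normK (num_real u)); field; rewrite gt_eqF.
    by rewrite e in h; have := normr_ge0 u; lra.
rewrite ge0_integralD//; last 3 first.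
- by move=> x _; rewrite lee_fin mulr_ge0 ?sqr_ge0.
- by apply/measurable_EFinP; exact: measurable_funM.
- by move=> x _; rewrite lee_fin invr_ge0 sqr_ge0.
rewrite integralZ_EFin//; last 2 first.
- by move=> x; exact: sqr_ge0.
- exact: sqr_ge0.
rewrite integral_cst_prob.
apply: (@le_trans _ _ ((q ^+ 2)%:E * (M / q ^+ 4)%:E + (q ^- 2)%:E)%E).
  rewrite leeD2r//; apply: lee_wpmul2l; first by rewrite lee_fin sqr_ge0.
  exact: integral_tmean_centered_sqr.
rewrite -EFinM -EFinD lee_fin le_eqVlt; apply/orP; left; apply/eqP.
by field; rewrite gt_eqF.
Qed.

End means.

Section error.
Context (R : realType) (rho : probability R R).
Hypothesis rho_sym : symmetric_measure rho.
Local Notation leb := (@lebesgue_measure R).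
Variables (sigma mu4 q : R) (n : nat).
Hypotheses (sigma0 : 0 < sigma) (q1 : 1 <= q) (qn : q ^+ 4 = n%:R).
Hypotheses (sigmaE : (\int[rho]_z (z ^+ 2)%:E = (sigma ^+ 2)%:E)%E)
  (mu4E : (\int[rho]_z (z ^+ 4)%:E = mu4%:E)%E).
Local Notation mun := (power_prob rho n).
Local Notation joint := (mun \x leb)%E.
Local Notation kern := (hs_kernel sigma q).
Implicit Types (x : n.-tuple R) (s : R).

Let q0 : 0 < q. Proof. exact: lt_le_trans q1. Qed.
Let n0 : 0 < n%:R :> R. Proof. by rewrite -qn exprn_gt0. Qed.

Let msq : measurable_fun setT (fun z : R => z ^+ 2).
Proof. exact: exprn_measurable. Qed.

Let mean_sq : (\int[mun]_x (tsum_sq x / n%:R)%:E = (sigma ^+ 2)%:E)%E.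
Proof.
exact: (integral_tmean q1 qn msq (fun z => sqr_ge0 z) sigmaE).
Qed.

Let mu4E' : (\int[rho]_z ((z ^+ 2) ^+ 2)%:E = mu4%:E)%E.
Proof. by rewrite -mu4E; apply: eq_integral => z _; rewrite -exprM. Qed.

Lemma mu4_ge0 : 0 <= mu4.
Proof.
rewrite -lee_fin -mu4E; apply: integral_ge0 => z _.
by rewrite lee_fin exprn_even_ge0.
Qed.

(** With r = sqrt (T / n) / sigma one has S / q^3 = r m, hence
S / q^3 - s = r (m - s) + (r - 1) s; and |r - 1| <= |r^2 - 1| since r >= 0, which leaves
only the empirical variance. *)
Lemma scaled_sum_dist x s : 0 < tsum_sq x ->
  (tsum x / q ^+ 3 - s) ^+ 2 <=
    2 * (tsum_sq x / n%:R / sigma ^+ 2) * (s - hs_mean sigma q x) ^+ 2 +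
    2 / sigma ^+ 4 * s ^+ 2 * (tsum_sq x / n%:R - sigma ^+ 2) ^+ 2.
Proof.
move=> T0; set w := Num.sqrt (tsum_sq x).
have w0 : 0 < w by rewrite sqrtr_gt0.
have TE : tsum_sq x = w ^+ 2 by rewrite sqr_sqrtr// ltW.
set m := hs_mean sigma q x; set r := w / (q ^+ 2 * sigma).
have r0 : 0 <= r by rewrite divr_ge0 ?mulr_ge0 ?sqr_ge0// ltW.
have -> : tsum x / q ^+ 3 = r * m.
  by rewrite /r /m /hs_mean -/w; field; rewrite !gt_eqF.
have -> : tsum_sq x / n%:R / sigma ^+ 2 = r ^+ 2.
  by rewrite TE -qn /r; field; rewrite !gt_eqF.
have -> : 2 / sigma ^+ 4 * s ^+ 2 * (tsum_sq x / n%:R - sigma ^+ 2) ^+ 2 =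
    2 * s ^+ 2 * (r ^+ 2 - 1) ^+ 2.
  by rewrite TE -qn /r; field; rewrite !gt_eqF.
have h1 : (r - 1) ^+ 2 <= (r ^+ 2 - 1) ^+ 2.
  have -> : (r ^+ 2 - 1) ^+ 2 = (r - 1) ^+ 2 * (r + 1) ^+ 2 by ring.
  by rewrite ler_peMr ?sqr_ge0// expr_ge1//; lra.
have h2 : (r - 1) ^+ 2 * s ^+ 2 <= (r ^+ 2 - 1) ^+ 2 * s ^+ 2.
  by rewrite ler_wpM2r ?sqr_ge0.
have h3 := sqr_ge0 (r * (m - s) - (r - 1) * s).
rewrite -subr_ge0.
have -> : 2 * r ^+ 2 * (s - m) ^+ 2 + 2 * s ^+ 2 * (r ^+ 2 - 1) ^+ 2 - (r * m - s) ^+ 2 =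
  (r * (m - s) - (r - 1) * s) ^+ 2 +
  2 * ((r ^+ 2 - 1) ^+ 2 * s ^+ 2 - (r - 1) ^+ 2 * s ^+ 2) by ring.
by rewrite addr_ge0// mulr_ge0// subr_ge0.
Qed.

Definition error_rate : R :=
  16 * dominant_mass sigma * sigma ^+ 2 + 2 / sigma ^+ 4 * dominant_moment sigma * mu4.

Lemma measurable_tsum1 : measurable_fun setT (fun p : n.-tuple R * R => tsum p.1).
Proof. exact: (measurableT_comp (@measurable_tsum R n) measurable_fst). Qed.

Lemma measurable_hs_mean : measurable_fun setT (@hs_mean R sigma q n).
Proof.
apply: measurable_funM => //; apply: measurable_funM; first exact: measurable_tsum.
exact: (measurableT_comp measurable_inv_sqrt (@measurable_tsum_sq R n)).
Qed.

(** The three terms are: the e-part, bounded by domination; the spread of s around its mean,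
for which the sample is fixed and the Gaussian second moment is used before
returning to the kernel; and the fluctuation of the empirical variance. *)
Lemma integral_joint_error_le (e c : R) : 0 <= e -> 0 <= c ->
  (\int[joint]_p ((e * (1 + p.2 ^+ 2) + c * (tsum p.1 / q ^+ 3 - p.2) ^+ 2) * kern p.1 p.2)%:E
   <= (e * (dominant_mass sigma + dominant_moment sigma) + c * (error_rate / q ^+ 2))%:E)%E.
Proof.
move=> e0 c0.
have s2 : 0 < sigma ^+ 2 by rewrite exprn_gt0.
have s4 : 0 < sigma ^+ 4 by rewrite exprn_gt0.
have q2 : 0 < q ^+ 2 by rewrite exprn_gt0.
have mk : measurable_fun setT (fun p : n.-tuple R * R => kern p.1 p.2).
  exact: measurable_hs_kernel.
have mT : measurable_fun setT (fun p : n.-tuple R * R => tsum_sq p.1 / n%:R).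
  by apply: measurable_funM => //; exact: measurable_tsum_sq1.
have mdom : measurable_fun setT (hs_dominant sigma) by exact: measurable_hs_dominant.
pose F1 (p : n.-tuple R * R) := e * (1 + p.2 ^+ 2) * (1 * kern p.1 p.2).
pose F2 (p : n.-tuple R * R) := 2 * c / sigma ^+ 2 * (tsum_sq p.1 / n%:R) *
   ((p.2 - hs_mean sigma q p.1) ^+ 2 * kern p.1 p.2).
pose F3 (p : n.-tuple R * R) := 2 * c / sigma ^+ 4 * p.2 ^+ 2 *
   ((tsum_sq p.1 / n%:R - sigma ^+ 2) ^+ 2 * kern p.1 p.2).
have mF1 : measurable_fun setT F1.
  apply: measurable_funM; last exact: measurable_funM.
  by apply: measurable_funM => //; apply: measurable_funD => //; exact: measurable_funX.
have mF2 : measurable_fun setT F2.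
  apply: measurable_funM; first exact: measurable_funM.
  apply: measurable_funM => //; apply: measurable_funX; apply: measurable_funB => //.
  exact: (measurableT_comp measurable_hs_mean measurable_fst).
have mF3 : measurable_fun setT F3.
  apply: measurable_funM.
    by apply: measurable_funM => //; exact: measurable_funX.
  by apply: measurable_funM => //; apply: measurable_funX; exact: measurable_funB.
have T0 (p : n.-tuple R * R) : 0 <= tsum_sq p.1 / n%:R.
  by rewrite divr_ge0// sumr_ge0// => i _; rewrite sqr_ge0.
have F10 p : 0 <= F1 p.
  by rewrite /F1 mul1r mulr_ge0 ?hs_kernel_ge0// mulr_ge0// addr_ge0// sqr_ge0.
have c2 : 0 <= 2 * c / sigma ^+ 2 by rewrite divr_ge0 ?mulr_ge0// ltW.
have c4 : 0 <= 2 * c / sigma ^+ 4 by rewrite divr_ge0 ?mulr_ge0// ltW.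
have F20 p : 0 <= F2 p.
  apply: mulr_ge0; first exact: mulr_ge0.
  by rewrite mulr_ge0 ?sqr_ge0 ?hs_kernel_ge0.
have F30 p : 0 <= F3 p.
  apply: mulr_ge0; first by rewrite mulr_ge0// sqr_ge0.
  by rewrite mulr_ge0 ?sqr_ge0 ?hs_kernel_ge0.
apply: (@le_trans _ _ (\int[joint]_p ((F1 p)%:E + ((F2 p)%:E + (F3 p)%:E)))%E).
  apply: ge0_le_integral => //.
  - move=> p _; rewrite lee_fin mulr_ge0 ?hs_kernel_ge0// addr_ge0// mulr_ge0 ?sqr_ge0//.
    by rewrite addr_ge0// sqr_ge0.
  - apply/measurable_EFinP; apply: measurable_funM => //.
    apply: measurable_funD.
      by apply: measurable_funM => //; apply: measurable_funD => //; exact: measurable_funX.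
    apply: measurable_funM => //; apply: measurable_funX; apply: measurable_funB => //.
    by apply: measurable_funM => //; exact: measurable_tsum1.
  - by apply: emeasurable_funD; [|apply: emeasurable_funD]; exact/measurable_EFinP.
  - move=> p _; rewrite -!EFinD lee_fin /F1 mul1r mulrDl lerD2l.
    rewrite /F2 /F3; have [T1|T1] := ltP 0 (tsum_sq p.1); last first.
      have -> : kern p.1 p.2 = 0.
        rewrite /hs_kernel /supp_ind indicE memNset ?mulr0//= => T2.
        by rewrite ltNge T1 in T2.
      by rewrite !mulr0 addr0.
    have := ler_wpM2r (hs_kernel_ge0 sigma q p.1 p.2)
       (ler_wpM2l c0 (scaled_sum_dist p.2 T1)).
    move=> /le_trans; apply; rewrite le_eqVlt; apply/orP; left; apply/eqP.
    by field; rewrite !gt_eqF.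
rewrite ge0_integralD//; last 4 first.
- by move=> p _; rewrite lee_fin.
- exact/measurable_EFinP.
- by move=> p _; rewrite -EFinD lee_fin addr_ge0.
- by apply: emeasurable_funD; exact/measurable_EFinP.
rewrite ge0_integralD//; last 4 first.
- by move=> p _; rewrite lee_fin.
- exact/measurable_EFinP.
- by move=> p _; rewrite lee_fin.
- exact/measurable_EFinP.
have I1 : (\int[joint]_p (F1 p)%:E <= (e * (dominant_mass sigma + dominant_moment sigma) * 1)%:E)%E.
  apply: (@integral_joint_le _ _ rho_sym _ _ _ sigma0 q1 qn (fun s => e * (1 + s ^+ 2)) (fun=> 1)) => //.
  - by apply: measurable_funM => //; apply: measurable_funD => //; exact: exprn_measurable.
  - by move=> s; rewrite mulr_ge0// addr_ge0// sqr_ge0.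
  - under eq_integral do rewrite -mulrA.
    rewrite integralZ_EFin; last 3 first.
    + apply: measurable_funM => //; apply: measurable_funD => //.
    + by move=> s; rewrite mulr_ge0 ?hs_dominant_ge0// addr_ge0// sqr_ge0.
    + exact: e0.
    rewrite [X in (_ <= X)%E]EFinM; apply: lee_wpmul2l; first by rewrite lee_fin.
    under eq_integral do rewrite mulrDl mul1r EFinD.
    rewrite ge0_integralD//; last 4 first.
    + by move=> s _; rewrite lee_fin hs_dominant_ge0.
    + exact/measurable_EFinP.
    + by move=> s _; rewrite lee_fin mulr_ge0 ?hs_dominant_ge0// sqr_ge0.
    + by apply/measurable_EFinP; exact: measurable_funM.
    by rewrite integral_hs_dominant// EFinD leeD2l// integral_hs_dominant_sqr.
  - by rewrite integral_cst_prob.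
have I2 : (\int[joint]_p (F2 p)%:E <= (16 * c / q ^+ 2 * dominant_mass sigma * sigma ^+ 2)%:E)%E.
  rewrite fubini_tonelli1; last 2 first.
  - exact/measurable_EFinP.
  - by move=> p; rewrite lee_fin.
  (* The absolute value makes ph nonnegative everywhere; sums of squares do not see it. *)
  pose ph (t : R) : R := `|t| / n%:R.
  have mph1 : measurable_fun setT ph.
    by apply: measurable_funM => //; exact: normr_measurable.
  have ph1 t : 0 <= ph t by rewrite divr_ge0.
  have phE x : ph (tsum_sq x) = tsum_sq x / n%:R.
    by rewrite /ph ger0_norm// sumr_ge0// => i _; exact: sqr_ge0.
  have mph : measurable_fun setT (fun x : n.-tuple R => 16 * c / q ^+ 2 * ph (tsum_sq x)).
    apply: measurable_funM => //; apply: measurableT_comp => //.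
    exact: measurable_tsum_sq.
  have ph0 x : 0 <= 16 * c / q ^+ 2 * ph (tsum_sq x).
    by apply: mulr_ge0 => //; rewrite divr_ge0 ?mulr_ge0// ltW.
  apply: (@le_trans _ _ (\int[mun]_x (16 * c / q ^+ 2 * ph (tsum_sq x) *
        (hs_mass sigma q * weight x))%:E)%E).
    apply: ge0_le_integral => //.
    - by move=> x _; apply: integral_ge0 => s _; rewrite lee_fin.
    - apply: (measurable_fun_fubini_tonelli_F (m2 := leb) (fun p : n.-tuple R * R => (F2 p)%:E)).
        exact/measurable_EFinP.
      by move=> p; rewrite lee_fin.
    - apply/measurable_EFinP; apply: measurable_funM => //.
      by apply: measurable_funM => //; exact: measurable_weight.
    - move=> x _; rewrite /fubini_F/F2/=.
      rewrite integralZ_EFin; last 3 first.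
      + apply: measurable_funM.
          by apply: measurable_funX; exact: measurable_funB.
        exact: (measurableT_comp mk (pair1_measurable x)).
      + by move=> s; rewrite mulr_ge0 ?sqr_ge0 ?hs_kernel_ge0.
      + by apply: mulr_ge0 => //; exact: (T0 (x, 0)).
      apply: (@le_trans _ _ ((2 * c / sigma ^+ 2 * (tsum_sq x / n%:R))%:E *
         (8 / (q / sigma) ^+ 2 * (hs_mass sigma q * weight x))%:E)%E).
        apply: lee_wpmul2l; last exact: integral_hs_kernel_sqr.
        by rewrite lee_fin mulr_ge0//; exact: (T0 (x, 0)).
      rewrite -EFinM lee_fin le_eqVlt; apply/orP; left; apply/eqP.
      by rewrite phE; field; rewrite !gt_eqF.
  rewrite -(integral_joint_fst _ sigma0 q1 mph ph0).
  under eq_integral do rewrite -mulrA.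
  apply: (@integral_joint_le _ _ rho_sym _ _ _ sigma0 q1 qn (fun=> 16 * c / q ^+ 2) ph) => //.
  - by move=> s; rewrite divr_ge0 ?mulr_ge0// ltW.
  - exact: sqr_ge0.
  - rewrite integralZ_EFin//; last 2 first.
    + by move=> s; exact: hs_dominant_ge0.
    + by rewrite divr_ge0 ?mulr_ge0// ltW.
    by rewrite integral_hs_dominant// -EFinM.
  - by under eq_integral do rewrite phE; rewrite mean_sq.
have I3 : (\int[joint]_p (F3 p)%:E <= (2 * c / sigma ^+ 4 * dominant_moment sigma * (mu4 / q ^+ 4))%:E)%E.
  apply: (@integral_joint_le _ _ rho_sym _ _ _ sigma0 q1 qn
    (fun s => 2 * c / sigma ^+ 4 * s ^+ 2) (fun t => (t / n%:R - sigma ^+ 2) ^+ 2)) => //.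
  - by apply: measurable_funM => //; exact: exprn_measurable.
  - by move=> s; rewrite mulr_ge0// sqr_ge0.
  - by apply: measurable_funX; apply: measurable_funB => //; exact: measurable_funM.
  - by move=> t; exact: sqr_ge0.
  - by rewrite divr_ge0 ?mu4_ge0// exprn_ge0// ltW.
  - under eq_integral do rewrite -mulrA.
    rewrite integralZ_EFin//; last 2 first.
    + by apply: measurable_funM => //; exact: exprn_measurable.
    + by move=> s; rewrite mulr_ge0 ?hs_dominant_ge0// sqr_ge0.
    rewrite [X in (_ <= X)%E]EFinM; apply: lee_wpmul2l; first by rewrite lee_fin.
    exact: integral_hs_dominant_sqr.
  - exact: (integral_tmean_centered_sqr q1 qn msq (fun z => sqr_ge0 z) sigmaE mu4E').
apply: (le_trans (leeD I1 (leeD I2 I3))).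
rewrite -!EFinD lee_fin mulr1 lerD2l /error_rate.
have h : mu4 / q ^+ 4 <= mu4 / q ^+ 2.
  rewrite ler_wpM2l ?mu4_ge0// lef_pV2 ?posrE ?exprn_gt0//.
  by rewrite ler_weXn2l.
have K2 : 0 <= 2 * c / sigma ^+ 4 * dominant_moment sigma.
  by rewrite mulr_ge0// mulr_ge0 ?dominant_mass_ge0// mulr_ge0// sqr_ge0.
apply: (@le_trans _ _ (16 * c / q ^+ 2 * dominant_mass sigma * sigma ^+ 2 +
  2 * c / sigma ^+ 4 * dominant_moment sigma * (mu4 / q ^+ 2))).
  by rewrite lerD2l ler_wpM2l.
by rewrite le_eqVlt; apply/orP; left; apply/eqP; field; rewrite !gt_eqF.
Qed.

End error.

(** * Test functions and the limit of the averaged kernel *)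

Section modulus.
Context {R : realType}.

(** Heine's theorem, with only one of the two points confined to the segment. *)
Lemma continuous_uniform_near_segment (f : R -> R) (K e : R) :
  continuous f -> 0 < e ->
  exists2 dl : R, 0 < dl &
    forall a b, `|b| <= K -> `|a - b| < dl -> `|f a - f b| <= e.
Proof.
move=> cf e0; have e2 : 0 < e / 2 by rewrite divr_gt0.
pose P (dl b : R) := forall a, `|a - b| < dl -> `|f a - f b| <= e.
have cK := @segment_compact R (- K) K.
have /compact_near_coveringP cov := cK.
have : \forall dl \near (0 : R)^'+, `[- K, K]%classic `<=` P dl.
  apply: (cov R (0 : R)^'+ P _) => x _.
  have := cf x; move=> /cvgrPdist_lt/(_ _ e2)/nbhs_ballP[eta /= eta0 H].
  have eta2 : 0 < eta / 2 by rewrite divr_gt0.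
  exists (ball x (eta / 2), [set dl : R | dl < eta / 2]) => /=.
    split; first exact: nbhsx_ballx.
    exact: nbhs_right_lt.
  move=> [b dl] /= [xb dle] a ab.
  have h1 : `|f x - f b| < e / 2.
    apply: H; rewrite /ball /=; apply: lt_le_trans xb _; lra.
  have h2 : `|f x - f a| < e / 2.
    apply: H; rewrite /ball /=.
    have -> : x - a = (x - b) - (a - b) by ring.
    apply: le_lt_trans (ler_normB _ _) _.
    by move: xb; rewrite /ball /= => xb; lra.
  have -> : f a - f b = (f x - f b) - (f x - f a) by ring.
  apply: le_trans (ler_normB _ _) _; lra.
move=> nr.
near ((0 : R)^'+) => dl.
have Pdl : `[- K, K]%classic `<=` P dl by near: dl; exact: nr.
exists dl; first by near: dl; exact: nbhs_right_gt.
move=> a b bK; apply: Pdl.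
by rewrite /= in_itv/= -ler_norml.
Unshelve. all: by end_near. Qed.

(** Reduces test functions to second moments. Uniform continuity handles b in a large
segment and a close to b; when a is far from b the term c (a - b)^2 is at least 2 M, and
when b is outside the segment e b^2 is. *)
Lemma bounded_continuous_modulus (f : R -> R) (M e : R) :
  continuous f -> (forall z, `|f z| <= M) -> 0 < e ->
  exists2 c : R, 0 <= c &
    forall a b, `|f a - f b| <= e * (1 + b ^+ 2) + c * (a - b) ^+ 2.
Proof.
move=> cf fM e0; have M0 : 0 <= M by apply: le_trans (fM 0).
(* Chosen so that e K^2 >= 2 M. *)
pose K := 1 + 2 * M / e.
have [dl dl0 Hdl] := continuous_uniform_near_segment K cf e0.
have d2 : 0 < dl ^+ 2 by rewrite exprn_gt0.
have c0 : 0 <= 2 * M / dl ^+ 2 by rewrite divr_ge0 ?mulr_ge0// ltW.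
exists (2 * M / dl ^+ 2) => // a b.
have fab : `|f a - f b| <= 2 * M.
  by apply: le_trans (ler_normB _ _) _; have := fM a; have := fM b; lra.
have t1 : 0 <= 2 * M / dl ^+ 2 * (a - b) ^+ 2 by rewrite mulr_ge0 ?sqr_ge0.
have t2 : 0 <= e * b ^+ 2 by rewrite mulr_ge0 ?sqr_ge0 ?ltW.
have [bK|Kb] := leP `|b| K.
  have [ab|ab] := ltP `|a - b| dl.
    by have := Hdl _ _ bK ab; lra.
  have : dl ^+ 2 <= (a - b) ^+ 2.
    by rewrite -(real_normK (num_real (a - b))) lerXn2r// nnegrE ltW.
  move=> h; have : 2 * M <= 2 * M / dl ^+ 2 * (a - b) ^+ 2.
    by rewrite mulrAC ler_pdivlMr// ler_wpM2l// mulr_ge0.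
  lra.
have : 2 * M <= e * b ^+ 2.
  have k0 : 0 <= 2 * M / e by rewrite divr_ge0 ?mulr_ge0// ltW.
  have hb : K ^+ 2 <= b ^+ 2.
    rewrite -(real_normK (num_real b)) lerXn2r// ?nnegrE ?(ltW Kb)//.
    by rewrite addr_ge0.
  have hk : 2 * M / e <= b ^+ 2.
    by apply: le_trans hb; rewrite /K; nra.
  by move: hk; rewrite ler_pdivrMr// [b ^+ 2 * _]mulrC.
lra.
Qed.

End modulus.

Section limit_kernel.
Context (R : realType) (rho : probability R R).
Hypothesis rho_sym : symmetric_measure rho.
Local Notation leb := (@lebesgue_measure R).
Variables (sigma mu4 mu6 mu8 q : R) (n : nat).
Hypotheses (sigma0 : 0 < sigma) (q1 : 1 <= q) (qn : q ^+ 4 = n%:R).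
Hypotheses (sigmaE : (\int[rho]_z (z ^+ 2)%:E = (sigma ^+ 2)%:E)%E)
  (mu4E : (\int[rho]_z (z ^+ 4)%:E = mu4%:E)%E)
  (mu6E : (\int[rho]_z (z ^+ 6)%:E = mu6%:E)%E)
  (mu8E : (\int[rho]_z (z ^+ 8)%:E = mu8%:E)%E).
Local Notation mun := (power_prob rho n).
Implicit Types (x : n.-tuple R) (s : R).

Let q0 : 0 < q. Proof. exact: lt_le_trans q1. Qed.

Definition quartic_kernel s : R :=
  expR (- (mu4 / (12 * (sigma ^+ 2) ^+ 2) * (s / sigma) ^+ 4)).

Definition gap_rate s : R :=
  quartic_rate (sigma ^+ 2) mu4 (s / sigma) * (mu8 + 1 + (mu4 + 1 + mu6)).

Definition gap_density_mean s : \bar R :=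
  (\int[mun]_x (gap_density sigma q x s)%:E)%E.

Let mx k : measurable_fun setT (fun z : R => z ^+ k).
Proof. exact: exprn_measurable. Qed.

Let mgap s : measurable_fun setT (fun x : n.-tuple R => gap_density sigma q x s).
Proof.
exact: (measurableT_comp (@measurable_gap_density R sigma q n) (pair2_measurable s)).
Qed.

(** The law of large numbers, in mean: each empirical moment is within O(q^-2) of its
expectation. Two inequalities between nonnegative integrals take the place of the integral
of a signed difference. *)
Lemma gap_density_mean_dist s :
  (gap_density_mean s <= (quartic_kernel s + gap_rate s / q ^+ 2)%:E /\
   (quartic_kernel s)%:E <= gap_density_mean s + (gap_rate s / q ^+ 2)%:E)%E.
Proof.
have s2 : 0 < sigma ^+ 2 by rewrite exprn_gt0.
have m4 := mu4_ge0 mu4E.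
set r := quartic_rate (sigma ^+ 2) mu4 (s / sigma).
have r0 : 0 <= r by exact: quartic_rate_ge0.
pose Dl x := r * (`|tmean (fun z => z ^+ 4) x - mu4| +
   (`|tmean (fun z => z ^+ 2) x - sigma ^+ 2| + q ^- 2 * tmean (fun z => z ^+ 6) x)).
have e6 x : 0 <= tmean (fun z => z ^+ 6) x.
  by rewrite divr_ge0// sumr_ge0// => i _; rewrite exprn_even_ge0.
have q2 : 0 <= q ^- 2 by rewrite invr_ge0 sqr_ge0.
have Dl0 x : 0 <= Dl x.
  by rewrite /Dl mulr_ge0// !addr_ge0// mulr_ge0.
have mm k m : measurable_fun setT (fun x : n.-tuple R => `|tmean (fun z => z ^+ k) x - m|).
  apply: measurableT_comp => //; apply: measurable_funB => //.
  exact: (measurable_tmean (mx k)).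
have m6 : measurable_fun setT (fun x : n.-tuple R => q ^- 2 * tmean (fun z => z ^+ 6) x).
  by apply: measurable_funM => //; exact: (measurable_tmean (mx 6)).
have m26 : measurable_fun setT (fun x : n.-tuple R =>
   `|tmean (fun z => z ^+ 2) x - sigma ^+ 2| + q ^- 2 * tmean (fun z => z ^+ 6) x).
  by apply: measurable_funD => //; exact: mm.
have mDl : measurable_fun setT Dl.
  by apply: measurable_funM => //; apply: measurable_funD => //; exact: mm.
have dist x : `|gap_density sigma q x s - quartic_kernel s| <= Dl x.
  have := gap_sum_dist (s / sigma) x s2 m4 q1 qn.
  rewrite /gap_density /supp_ind !indicE.
  have -> : (x \in [set y : n.-tuple R | 0 < tsum_sq y]) = (tsum_sq x \in [set t | 0 < t]).
    by apply/idP/idP; rewrite !inE.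
  by rewrite /Dl addrA [q ^- 2 * _]mulrC.
have IDl : (\int[mun]_x (Dl x)%:E <= (gap_rate s / q ^+ 2)%:E)%E.
  rewrite integralZ_EFin//; last 2 first.
  - by apply: measurable_funD => //; exact: mm.
  - by move=> x; rewrite !addr_ge0// mulr_ge0.
  rewrite /gap_rate -/r -mulrA [X in (_ <= X)%E]EFinM.
  apply: lee_wpmul2l; first by rewrite lee_fin.
  under eq_integral do rewrite EFinD.
  rewrite ge0_integralD//; last 3 first.
  - by apply/measurable_EFinP; exact: mm.
  - by move=> x _; rewrite lee_fin addr_ge0// mulr_ge0.
  - exact/measurable_EFinP.
  rewrite mulrDl EFinD; apply: leeD.
    apply: (integral_tmean_dist q1 qn (mx 4) _ mu4E).
      by move=> z; rewrite exprn_even_ge0.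
    by rewrite -mu8E; apply: eq_integral => z _; rewrite -exprM.
  under eq_integral do rewrite EFinD.
  rewrite ge0_integralD//; last 3 first.
  - by apply/measurable_EFinP; exact: mm.
  - by move=> x _; rewrite lee_fin mulr_ge0.
  - exact/measurable_EFinP.
  rewrite mulrDl EFinD; apply: leeD.
    apply: (integral_tmean_dist q1 qn (mx 2) _ sigmaE).
      by move=> z; exact: sqr_ge0.
    by rewrite -mu4E; apply: eq_integral => z _; rewrite -exprM.
  rewrite integralZ_EFin//; last exact: (measurable_tmean (mx 6)).
  rewrite (integral_tmean q1 qn (mx 6) _ mu6E); last first.
    by move=> z; rewrite exprn_even_ge0.
  by rewrite -EFinM mulrC.
have q0' : 0 <= quartic_kernel s by exact: expR_ge0.
split.
  apply: (@le_trans _ _ (\int[mun]_x ((quartic_kernel s)%:E + (Dl x)%:E))%E).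
    apply: ge0_le_integral => //.
    - by move=> x _; rewrite lee_fin gap_density_ge0.
    - by apply/measurable_EFinP; exact: mgap.
    - by apply: emeasurable_funD => //; exact/measurable_EFinP.
    - move=> x _; rewrite -EFinD lee_fin.
      by have := dist x; rewrite ler_norml => /andP[_]; lra.
  rewrite ge0_integralD//; last 2 first.
  - by move=> x _; rewrite lee_fin.
  - exact/measurable_EFinP.
  by rewrite integral_cst_prob EFinD leeD2l.
rewrite -[leLHS](integral_cst_prob mun).
apply: (@le_trans _ _ (\int[mun]_x ((gap_density sigma q x s)%:E + (Dl x)%:E))%E).
  apply: ge0_le_integral => //.
  - by apply: emeasurable_funD; apply/measurable_EFinP => //; exact: mgap.
  - move=> x _; rewrite -EFinD lee_fin.
    by have := dist x; rewrite ler_norml => /andP[+ _]; lra.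
rewrite ge0_integralD//; last 4 first.
- by move=> x _; rewrite lee_fin gap_density_ge0.
- by apply/measurable_EFinP; exact: mgap.
- by move=> x _; rewrite lee_fin.
- exact/measurable_EFinP.
by rewrite leeD2l.
Qed.

Lemma gap_density_mean_ge0 s : (0 <= gap_density_mean s)%E.
Proof. by apply: integral_ge0 => x _; rewrite lee_fin gap_density_ge0. Qed.

Lemma gap_density_mean_le s : (gap_density_mean s <= (hs_dominant sigma s)%:E)%E.
Proof.
rewrite -[leRHS](integral_cst_prob mun); apply: ge0_le_integral => //.
- by move=> x _; rewrite lee_fin gap_density_ge0.
- by apply/measurable_EFinP; exact: mgap.
- by move=> x _; rewrite lee_fin; exact: gap_density_le.
Qed.

Lemma measurable_gap_density_mean : measurable_fun setT gap_density_mean.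
Proof.
apply: (measurable_fun_fubini_tonelli_G (m1 := mun)
  (fun p : n.-tuple R * R => (gap_density sigma q p.1 p.2)%:E)).
  by apply/measurable_EFinP; exact: measurable_gap_density.
by move=> p; rewrite lee_fin gap_density_ge0.
Qed.

Section comparison.
Variables (f : R -> R) (e c : R).
Hypotheses (mf : measurable_fun setT f) (f0 : forall z, 0 <= f z)
  (e0 : 0 <= e) (c0 : 0 <= c)
  (fmod : forall a b, `|f a - f b| <= e * (1 + b ^+ 2) + c * (a - b) ^+ 2).

Definition scaled_integral : \bar R :=
  (\int[mun]_x (f (tsum x / q ^+ 3) * (hs_mass sigma q * weight x))%:E)%E.

Definition smoothed_integral : \bar R :=
  (\int[leb]_s ((f s)%:E * gap_density_mean s))%E.

Definition smoothing_error : R :=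
  e * (dominant_mass sigma + dominant_moment sigma) + c * (error_rate sigma mu4 / q ^+ 2).

(** Both integrals are integrals of the kernel over the samples and s, of f (S / q^3) for the
first and of f (s) for the second. *)
Lemma scaled_smoothed_dist :
  (scaled_integral <= smoothed_integral + smoothing_error%:E /\
   smoothed_integral <= scaled_integral + smoothing_error%:E)%E.
Proof.
pose kern := hs_kernel sigma q (n := n).
have mk : measurable_fun setT (fun p : n.-tuple R * R => kern p.1 p.2).
  exact: measurable_hs_kernel.
have k0 (p : n.-tuple R * R) : 0 <= kern p.1 p.2 by exact: hs_kernel_ge0.
have mS : measurable_fun setT (fun x : n.-tuple R => tsum x / q ^+ 3).
  by apply: measurable_funM => //; exact: measurable_tsum.
have mfS : measurable_fun setT (fun x : n.-tuple R => f (tsum x / q ^+ 3)).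
  exact: (measurableT_comp mf mS).
pose FA (p : n.-tuple R * R) := f (tsum p.1 / q ^+ 3) * kern p.1 p.2.
pose FB (p : n.-tuple R * R) := f p.2 * (1 * kern p.1 p.2).
pose FE (p : n.-tuple R * R) :=
  (e * (1 + p.2 ^+ 2) + c * (tsum p.1 / q ^+ 3 - p.2) ^+ 2) * kern p.1 p.2.
have mFA : measurable_fun setT FA.
  by apply: measurable_funM => //; exact: (measurableT_comp mfS measurable_fst).
have mFB : measurable_fun setT FB.
  apply: measurable_funM; first exact: (measurableT_comp mf measurable_snd).
  exact: measurable_funM.
have mFE : measurable_fun setT FE.
  apply: measurable_funM => //; apply: measurable_funD.
    by apply: measurable_funM => //; apply: measurable_funD => //; exact: measurable_funX.
  apply: measurable_funM => //; apply: measurable_funX; apply: measurable_funB => //.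
  exact: (measurableT_comp mS measurable_fst).
have FA0 p : 0 <= FA p by exact: mulr_ge0.
have FB0 p : 0 <= FB p by rewrite /FB mul1r mulr_ge0.
have FE0 p : 0 <= FE p.
  rewrite /FE; apply: mulr_ge0 => //; apply: addr_ge0; apply: mulr_ge0 => //.
    by rewrite addr_ge0// sqr_ge0.
  exact: sqr_ge0.
have eA : (\int[mun \x leb]_p (FA p)%:E = scaled_integral)%E.
  exact: (integral_joint_fst rho sigma0 q1 (ph := fun x => f (tsum x / q ^+ 3))).
have eB : (\int[mun \x leb]_p (FB p)%:E = smoothed_integral)%E.
  have e1 := @integral_joint_snd _ _ rho_sym sigma q n f (fun=> 1) mf f0
    (measurable_cst _) (fun=> ler01).
  apply: (etrans e1); apply: eq_integral => s _; congr (_ * _)%E.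
  by apply: eq_integral => x _; rewrite mul1r.
have eE : (\int[mun \x leb]_p (FE p)%:E <= smoothing_error%:E)%E.
  exact: (integral_joint_error_le rho_sym sigma0 q1 qn sigmaE mu4E e0 c0).
have le (G1 G2 : n.-tuple R * R -> R) : measurable_fun setT G1 -> measurable_fun setT G2 ->
  (forall p, 0 <= G1 p) -> (forall p, 0 <= G2 p) -> (forall p, G1 p <= G2 p + FE p) ->
  (\int[mun \x leb]_p (G1 p)%:E <= \int[mun \x leb]_p (G2 p)%:E + smoothing_error%:E)%E.
  move=> mG1 mG2 G10 G20 h.
  apply: (@le_trans _ _ (\int[mun \x leb]_p ((G2 p)%:E + (FE p)%:E))%E).
    apply: ge0_le_integral => //.
    - by move=> p _; rewrite lee_fin.
    - exact/measurable_EFinP.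
    - by apply: emeasurable_funD; exact/measurable_EFinP.
    - by move=> p _; rewrite -EFinD lee_fin.
  rewrite ge0_integralD//; last 4 first.
  - by move=> p _; rewrite lee_fin.
  - exact/measurable_EFinP.
  - by move=> p _; rewrite lee_fin.
  - exact/measurable_EFinP.
  by rewrite leeD2l.
have fE p : `|f (tsum p.1 / q ^+ 3) - f p.2| * kern p.1 p.2 <= FE p.
  by rewrite ler_wpM2r.
rewrite -eA -eB; split; apply: le => // p.
  rewrite /FB mul1r -lerBlDl -mulrBl; apply: le_trans (fE p).
  by rewrite ler_wpM2r// ler_norm.
rewrite /FB mul1r -lerBlDl -mulrBl; apply: le_trans (fE p).
by rewrite ler_wpM2r// distrC ler_norm.
Qed.

End comparison.

End limit_kernel.

(** * The normalising constant of the quartic density *)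

Section quartic.
Context (R : realType) (c : R).
Hypothesis c0 : 0 < c.
Local Notation leb := (@lebesgue_measure R).

Definition quartic_exp (s : R) : R := expR (- (c * s ^+ 4)).

Lemma quartic_exp_ge0 s : 0 <= quartic_exp s. Proof. exact: expR_ge0. Qed.

Lemma measurable_quartic_exp : measurable_fun setT quartic_exp.
Proof.
apply: measurableT_comp => //; apply: measurableT_comp => //.
by apply: measurable_funM => //; exact: exprn_measurable.
Qed.

Lemma measurable_quartic_exp_EFin D : measurable_fun D (fun s => (quartic_exp s)%:E).
Proof. by apply: measurable_funTS; apply/measurable_EFinP; exact: measurable_quartic_exp. Qed.

Definition quartic_mass : R := fine (\int[leb]_s (quartic_exp s)%:E)%E.

Lemma integral_quartic_exp_lty : (\int[leb]_s (quartic_exp s)%:E < +oo)%E.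
Proof.
apply: (@le_lt_trans _ _ (\int[leb]_s (expR (16 * c)^-1 *
   expR (- ((1 * (s - 0)) ^+ 2 / 2)))%:E)%E).
  apply: ge0_le_integral => //.
  - by move=> s _; rewrite lee_fin quartic_exp_ge0.
  - exact: measurable_quartic_exp_EFin.
  - by apply/measurable_EFinP/measurable_funM => //; exact: measurable_gauss.
  - move=> s _; rewrite lee_fin -expRD ler_expR mul1r subr0 -subr_ge0.
    have -> : (16 * c)^-1 - s ^+ 2 / 2 - - (c * s ^+ 4) = (4 * c * s ^+ 2 - 1) ^+ 2 / (16 * c).
      by field; rewrite gt_eqF.
    by rewrite divr_ge0 ?sqr_ge0// mulr_ge0// ltW.
rewrite integralZ_EFin; last 3 first.
- exact: measurable_gauss.
- by move=> s; exact: expR_ge0.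
- exact: expR_ge0.
by rewrite integral_gauss// -EFinM ltry.
Qed.

Lemma quartic_massE : (\int[leb]_s (quartic_exp s)%:E = quartic_mass%:E)%E.
Proof.
rewrite /quartic_mass fineK// ge0_fin_numE; first exact: integral_quartic_exp_lty.
by apply: integral_ge0 => s _; rewrite lee_fin quartic_exp_ge0.
Qed.

Lemma quartic_mass_gt0 : 0 < quartic_mass.
Proof.
rewrite -lte_fin -quartic_massE.
apply: (@lt_le_trans _ _ (\int[leb]_(s in `[0%R, 1%R]) (expR (- c))%:E)%E).
  rewrite integral_cst//= lebesgue_measure_itv/= lte01 oppr0 adde0 mule1.
  by rewrite lte_fin expR_gt0.
apply: (@le_trans _ _ (\int[leb]_(s in `[0%R, 1%R]) (quartic_exp s)%:E)%E).
  apply: ge0_le_integral => //.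
  - exact: measurable_quartic_exp_EFin.
  - move=> s /=; rewrite in_itv/= => /andP[s0 s1].
    rewrite lee_fin ler_expR lerN2 -[leRHS]mulr1 ler_wpM2l ?(ltW c0)//.
    exact: exprn_ile1.
apply: ge0_subset_integral => //.
- exact: measurable_quartic_exp_EFin.
- by move=> s _; rewrite lee_fin quartic_exp_ge0.
Qed.

Lemma integral_quartic_half :
  (\int[leb]_s (quartic_exp s)%:E = 2%:E * \int[leb]_(s in `]0%R, +oo[) (quartic_exp s)%:E)%E.
Proof.
have U : [set: R] = `]-oo, 0%R] `|` `]0%R, +oo[.
  apply/seteqP; split => // s _ /=; rewrite !in_itv/= andbT.
  by have [|] := leP s 0; [left|right].
rewrite U ge0_integral_setU//=; last 3 first.
- exact: measurable_quartic_exp_EFin.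
- by move=> s _; rewrite lee_fin quartic_exp_ge0.
- apply/disj_setPS => s [/=]; rewrite !in_itv/= andbT => s0 s1.
  by move: s0; rewrite leNgt s1.
have -> : (\int[leb]_(s in `]-oo, 0%R]) (quartic_exp s)%:E =
   \int[leb]_(s in `]0%R, +oo[) (quartic_exp s)%:E)%E.
  have h := @ge0_integration_by_substitution0 R (fun s => (quartic_exp s)%:E).
  rewrite integral_itv_obnd_cbnd; last exact: measurable_quartic_exp_EFin.
  rewrite h//; last 2 first.
  - exact: measurable_quartic_exp_EFin.
  - by move=> s; rewrite lee_fin quartic_exp_ge0.
  apply: eq_integral => s _; congr (_%:E); rewrite /quartic_exp.
  by congr (expR (- (c * _))); ring.
set I := (\int[leb]_(_ in _) _)%E.
have : (0 <= I)%E by apply: integral_ge0 => s _; rewrite lee_fin quartic_exp_ge0.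
case: I => [r| |]//= r0; first by rewrite -EFinD -EFinM mulrDl mul1r.
by rewrite gt0_muley// lte_fin.
Qed.

Let G (t : R) : R := t `^ (1 / 4 - 1) * expR (- t).
Let F (s : R) : R := c * s ^+ 4.

Let G0 t : 0 <= G t. Proof. by rewrite mulr_ge0 ?expR_ge0 ?powR_ge0. Qed.

Let FE : F = c *: ((fun s : R => s ^+ 4) : R -> R). Proof. by []. Qed.

Let dF (s : R) : is_derive s 1 F (4 * c * s ^+ 3).
Proof. by rewrite FE; apply: is_derive_eq; rewrite /GRing.scale/=; ring. Qed.

Let F' : F^`()%classic = (fun s => 4 * c * s ^+ 3).
Proof. by apply/funext => s; rewrite derive1E; case: (dF s). Qed.

Let cF' : continuous F^`()%classic.
Proof.
rewrite F' => s; apply: cvgM; first exact: cvg_cst.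
exact: exprn_continuous.
Qed.

Let cF : continuous F.
Proof.
move=> s; apply: cvgM; first exact: cvg_cst.
exact: exprn_continuous.
Qed.

Let cG (t : R) : 0 < t -> {for t, continuous G}.
Proof.
move=> t0; apply: cvgM; last first.
  by apply: continuous_comp; [exact: continuousN|exact: continuous_expR].
have d : derivable (fun a : R => a `^ (1 / 4 - 1)) t 1.
  by apply: derivable_powR; rewrite in_itv/= t0.
by move/derivable1_diffP: d => /differentiable_continuous.
Qed.

Let lo (k : nat) : R := k.+1%:R^-1.
Let hi (k : nat) : R := k.+1%:R.

Let lo0 k : 0 < lo k. Proof. by rewrite invr_gt0. Qed.

Let lo_hi k : lo k <= hi k.
Proof.
rewrite /lo /hi; apply: (@le_trans _ _ 1); last by rewrite ler1n.
by rewrite invf_le1// ler1n.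
Qed.

Let F_mono a b : 0 <= a -> a < b -> F a < F b.
Proof. by move=> a0 ab; rewrite ltr_pM2l// ltrXn2r//= ?nnegrE// ltW// (le_lt_trans a0). Qed.

Let F_homo a b : 0 <= a -> a <= b -> F a <= F b.
Proof. by move=> a0 ab; rewrite ler_pM2l// lerXn2r ?nnegrE// (le_trans a0). Qed.

Lemma Gamma_substitution_bounded k :
  (\int[leb]_(t in `[F (lo k), F (hi k)]) (G t)%:E =
   \int[leb]_(s in `[lo k, hi k]) ((4 * c `^ (1 / 4)) * quartic_exp s)%:E)%E.
Proof.
rewrite integration_by_substitution_increasing//; last first.
- apply: continuous_in_subspaceT => t; rewrite inE/= in_itv/= => /andP[t0 _].
  apply: cG; apply: lt_le_trans t0.
  by rewrite mulr_gt0// exprn_gt0.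
- split.
  + by move=> x _; case: (dF x).
  + exact/cvg_at_right_filter/cF.
  + exact/cvg_at_left_filter/cF.
- by apply/cvg_ex; exists (F^`()%classic (hi k)); exact/cvg_at_left_filter/cF'.
- by apply/cvg_ex; exists (F^`()%classic (lo k)); exact/cvg_at_right_filter/cF'.
- move=> a b /=; rewrite !in_itv/= => /andP[a0 _] _; apply: F_mono.
  by apply: le_trans a0; exact: ltW.
apply: eq_integral => s; rewrite inE/= in_itv/= => /andP[s0 _].
have s1 : 0 < s by exact: lt_le_trans s0.
congr (_%:E); rewrite !fctE F' /G /F /quartic_exp.
have cs : 0 < c * s ^+ 4 by rewrite mulr_gt0// exprn_gt0.
have csb : (1 / 4 == 1 :> R) ==> (c * s ^+ 4 != 0) by rewrite (gt_eqF cs) implybT.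
rewrite (powRB csb) (powRr1 (ltW cs)) powRM ?(ltW c0) ?exprn_ge0 ?(ltW s1)//.
have -> : (s ^+ 4) `^ (1 / 4) = s.
  rewrite -powR_mulrn ?(ltW s1)// -powRrM.
  have -> : 4%:R * (1 / 4) = 1 :> R by field.
  by rewrite powRr1// ltW.
by field; rewrite !gt_eqF.
Qed.

Lemma bigcup_F_itv : \bigcup_k `[F (lo k), F (hi k)]%classic = `]0%R, +oo[%classic.
Proof.
apply/seteqP; split => [t [k _]|t] /=; rewrite !in_itv/=.
  move=> /andP[t0 _]; rewrite andbT; apply: lt_le_trans t0.
  by rewrite mulr_gt0// exprn_gt0.
rewrite andbT => t0.
have [k Hk] : exists k : nat, Num.max (t / c) (c / t) <= k%:R.
  by exists (Num.bound (Num.max (t / c) (c / t))); rewrite ltW// archi_boundP// le_max divr_ge0// ltW.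
move: Hk; rewrite ge_max => /andP[k1 k2].
exists k => //=; rewrite in_itv/=.
have k0 : 1 <= hi k by rewrite ler1n.
have kk : k%:R <= hi k by rewrite ler_nat.
have h4 : hi k <= hi k ^+ 4 by rewrite ler_eXnr.
apply/andP; split.
  rewrite /F /lo exprVn ler_pdivrMr ?exprn_gt0// -/(hi k).
  rewrite mulrC -ler_pdivrMr//.
  by apply: le_trans h4; apply: le_trans kk.
rewrite /F mulrC -ler_pdivrMr//.
by apply: le_trans h4; apply: le_trans kk.
Qed.

Lemma bigcup_itv : \bigcup_k `[lo k, hi k]%classic = `]0%R, +oo[%classic.
Proof.
apply/seteqP; split => [t [k _]|t] /=; rewrite !in_itv/=.
  by move=> /andP[t0 _]; rewrite andbT; apply: lt_le_trans t0.
rewrite andbT => t0.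
have [k Hk] : exists k : nat, Num.max t t^-1 <= k%:R.
  by exists (Num.bound (Num.max t t^-1)); rewrite ltW// archi_boundP// le_max ltW.
move: Hk; rewrite ge_max => /andP[k1 k2].
exists k => //=; rewrite in_itv/=.
have kk : k%:R <= hi k by rewrite ler_nat.
apply/andP; split; last exact: le_trans kk.
by rewrite /lo -[leRHS]invrK lef_pV2 ?posrE ?invr_gt0//; exact: le_trans kk.
Qed.

(** The substitution t = c s^4. The integrand on the left is singular at 0 and the derivative
of the substitution is unbounded, so it is carried out on the segments between 1 / (k + 1)
and k + 1, which exhaust the half-line. *)
Lemma integral_Gamma_quartic :
  (\int[leb]_(t in `]0%R, +oo[) (G t)%:E =
   (4 * c `^ (1 / 4))%:E * \int[leb]_(s in `]0%R, +oo[) (quartic_exp s)%:E)%E.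
Proof.
have mq : measurable_fun setT (fun s => (4 * c `^ (1 / 4) * quartic_exp s)%:E).
  by apply/measurable_EFinP/measurable_funM => //; exact: measurable_quartic_exp.
have c4 : 0 <= 4 * c `^ (1 / 4) by rewrite mulr_ge0 ?powR_ge0.
have mG : measurable_fun setT (fun t => (G t)%:E).
  apply/measurable_EFinP/measurable_funM; first exact: measurable_powR.
  by apply: measurableT_comp.
have lo_mono k m : (k <= m)%N -> lo m <= lo k.
  by move=> km; rewrite lef_pV2 ?posrE// ler_nat.
have hi_mono k m : (k <= m)%N -> hi k <= hi m by move=> km; rewrite ler_nat.
have hi0 k : 0 <= hi k by [].
have cvG : (\int[leb]_(t in `[F (lo k), F (hi k)]) (G t)%:E @[k --> \oo] -->
    \int[leb]_(t in `]0%R, +oo[) (G t)%:E)%E.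
  rewrite -bigcup_F_itv; apply: ge0_nondecreasing_set_cvg_integral.
  - move=> k m km; apply/subsetPset => t /=; rewrite !in_itv/= => /andP[t0 t1].
    apply/andP; split.
      by apply: le_trans t0; apply: F_homo; [exact: ltW|exact: lo_mono].
    by apply: (le_trans t1); apply: F_homo => //; exact: hi_mono.
  - by move=> k; exact: measurable_itv.
  - by move=> k; exact: measurable_funTS.
  - by move=> k t _; rewrite lee_fin.
have cvq : (\int[leb]_(s in `[lo k, hi k]) (4 * c `^ (1 / 4) * quartic_exp s)%:E
    @[k --> \oo] -->
    \int[leb]_(s in `]0%R, +oo[) (4 * c `^ (1 / 4) * quartic_exp s)%:E)%E.
  rewrite -bigcup_itv; apply: ge0_nondecreasing_set_cvg_integral.
  - move=> k m km; apply/subsetPset => t /=; rewrite !in_itv/= => /andP[t0 t1].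
    apply/andP; split; first by apply: le_trans t0; exact: lo_mono.
    by apply: (le_trans t1); exact: hi_mono.
  - by move=> k; exact: measurable_itv.
  - by move=> k; exact: measurable_funTS.
  - by move=> k t _; rewrite lee_fin mulr_ge0 ?quartic_exp_ge0.
transitivity (\int[leb]_(s in `]0%R, +oo[) (4 * c `^ (1 / 4) * quartic_exp s)%:E)%E; last first.
  under eq_integral do rewrite EFinM.
  rewrite ge0_integralZl//.
  - exact: measurable_quartic_exp_EFin.
  - by move=> s _; rewrite lee_fin quartic_exp_ge0.
rewrite (eq_fun Gamma_substitution_bounded) in cvG.
by rewrite -(cvg_lim _ cvG)// -(cvg_lim _ cvq).
Qed.

Lemma Gamma14E : Gamma (1 / 4 : R) = 2 * c `^ (1 / 4) * quartic_mass.
Proof.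
rewrite /Gamma /Rintegral integral_Gamma_quartic.
have := integral_quartic_half; rewrite quartic_massE.
set I := (\int[leb]_(_ in _) _)%E.
have : (0 <= I)%E by apply: integral_ge0 => s _; rewrite lee_fin quartic_exp_ge0.
case: I => [r| |]//=; last by rewrite gt0_muley ?lte_fin.
by move=> _ [->]; ring.
Qed.

End quartic.

Lemma limit_densityE (R : realType) (sigma mu4 s : R) : 0 < sigma -> 0 < mu4 ->
  limit_density sigma mu4 s =
  quartic_exp (mu4 / (12 * sigma ^+ 8)) s / quartic_mass (mu4 / (12 * sigma ^+ 8)).
Proof.
move=> sigma0 mu40; set c := mu4 / (12 * sigma ^+ 8).
have c0 : 0 < c by rewrite divr_gt0// mulr_gt0// exprn_gt0.
rewrite /limit_density -/c (Gamma14E c0) /quartic_exp mulNr [RHS]mulrC.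
congr (_ * _).
have -> : 4 * mu4 / (3 * sigma ^+ 8) = 2 ^+ 4 * c by rewrite /c; field; rewrite gt_eqF.
rewrite powRM ?(ltW c0)//.
have -> : (2 ^+ 4) `^ (1 / 4) = 2 :> R.
  rewrite -powR_mulrn// -powRrM.
  have -> : 4%:R * (1 / 4) = 1 :> R by field.
  by rewrite powRr1.
by field; rewrite gt_eqF ?quartic_mass_gt0//= gt_eqF// powR_gt0.
Qed.

Lemma probability_of_density d (T : measurableType d) (R : realType)
    (mu : {measure set T -> \bar R}) (p : T -> R) :
  measurable_fun setT p -> (forall x, 0 <= p x) ->
  (\int[mu]_x (p x)%:E = 1)%E ->
  exists nu : probability T R, forall A, measurable A ->
    nu A = (\int[mu]_(x in A) (p x)%:E)%E.
Proof.
move=> mp p0 p1; pose m (A : set T) := (\int[mu]_(x in A) (p x)%:E)%E.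
have m0 : m set0 = 0%E by rewrite /m integral_set0.
have m_ge0 A : (0 <= m A)%E by apply: integral_ge0 => x _; rewrite lee_fin.
have msa : semi_sigma_additive m.
  move=> F mF tF mUF; rewrite /m ge0_integral_bigcup//; last 2 first.
  - by apply: measurable_funTS; exact/measurable_EFinP.
  - by move=> x _; rewrite lee_fin.
  by apply: is_cvg_ereal_nneg_natsum_cond => n _ _; exact: m_ge0.
pose M1 := isMeasure.Build _ _ _ m m0 m_ge0 msa.
pose mm : {measure set T -> \bar R} := HB.pack m M1.
have mT : mm setT = 1%E by exact: p1.
pose M2 := Measure_isProbability.Build _ _ _ mm mT.
pose nu : probability T R := HB.pack_for (probability T R) (Measure.sort mm) M2.
by exists nu.
Qed.

(** Lebesgue measure lives on a copy of the real line with another display; the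
measure with the given density is transported by the identity. *)
Lemma probability_of_lebesgue_density (R : realType) (p : R -> R) :
  measurable_fun setT p -> (forall x, 0 <= p x) ->
  (\int[@lebesgue_measure R]_x (p x)%:E = 1)%E ->
  exists2 nu : probability R R,
    forall A : set R, measurable A ->
      nu A = (\int[lebesgue_measure]_(x in A) (p x)%:E)%E
    & forall f : R -> \bar R, measurable_fun setT f -> (forall x, (0 <= f x)%E) ->
      (\int[nu]_x f x = \int[lebesgue_measure]_x (f x * (p x)%:E))%E.
Proof.
move=> mp p0 p1.
have [nu nuE] :=
  @probability_of_density _ (measurableTypeR R) R lebesgue_measure p mp p0 p1.
have mid : measurable_fun setT (id : measurableTypeR R -> R).
  by move=> _ A mA; rewrite setTI.
pose X : {RV nu >-> R} := HB.pack (id : measurableTypeR R -> R)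
  (isMeasurableFun.Build _ _ _ _ (id : measurableTypeR R -> R) mid).
exists (distribution nu X) => [A mA|f mf f0]; first exact: nuE.
rewrite ge0_integral_distribution//.
exact: (@ge0_integral_density _ (measurableTypeR R) R lebesgue_measure nu p mp p0 nuE).
Qed.

(** Reduces bounded test functions to nonnegative ones. *)
Lemma integral_prob_shift d (T : measurableType d) (R : realType)
    (P : probability T R) (g : T -> R) (M : R) :
  measurable_fun setT g -> (forall x, `|g x| <= M) ->
  (\int[P]_x (g x)%:E = \int[P]_x (g x + M)%:E - M%:E)%E.
Proof.
move=> mg gM.
have ig : P.-integrable setT (EFin \o g).
  apply: measurable_bounded_integrable => //.
    by rewrite -ge0_fin_numE//; exact: fin_num_measure.
  by exists M; split; [exact: num_real|move=> N MN x _ /=; apply: (le_trans (gM x)); exact: ltW].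
have iM : P.-integrable setT (EFin \o (cst M : T -> R)).
  by apply: finite_measure_integrable_cst.
under [in RHS]eq_integral do rewrite EFinD.
rewrite (@integralD_EFin _ _ _ P setT measurableT g (cst M))//.
rewrite /= integral_cst_prob addeK//.
Qed.

(** * Passage to the limit *)

Section nondegenerate.
Context (R : realType) (rho : probability R R).
Hypothesis rho_neq0 : ~ is_dirac0 rho.
Variables (sigma mu4 : R).
Hypotheses (sigma_ge0 : 0 <= sigma)
  (sigmaE : (\int[rho]_z (z ^+ 2)%:E = (sigma ^+ 2)%:E)%E)
  (mu4E : (\int[rho]_z (z ^+ 4)%:E = mu4%:E)%E).

(** A zero second moment forces z = 0 almost surely, hence the Dirac mass at 0. *)
Lemma sigma_gt0 : 0 < sigma.
Proof.
rewrite lt_neqAle sigma_ge0 andbT eq_sym; apply/eqP => s0; apply: rho_neq0 => A mA.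
have msq : measurable_fun setT (fun z : R => (z ^+ 2)%:E).
  by apply/measurable_EFinP; exact: exprn_measurable.
have I0 : (\int[rho]_z `|(z ^+ 2)%:E| = 0)%E.
  transitivity (\int[rho]_z (z ^+ 2)%:E)%E.
    by apply: eq_integral => z _; rewrite gee0_abs// lee_fin sqr_ge0.
  by rewrite sigmaE s0 expr0n.
have [N [mN N0 sN]] := (ae_eq_integral_abs rho measurableT msq).1 I0.
have m1 : measurable [set~ (0 : R)] by apply: measurableC; exact: measurable_set1.
have C0 : rho [set~ 0] = 0%E.
  apply: (@subset_measure0 _ _ _ rho _ N) => // z /= z0; apply: sN => /=.
  by move=> /(_ Logic.I) [] /eqP; rewrite sqrf_eq0 => /eqP.
have S1 : rho [set 0] = 1%E.
  have := probability_setC rho (measurable_set1 (0 : R)); rewrite C0.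
  have : rho [set 0] \is a fin_num by exact: fin_num_measure.
  by case: (rho [set 0]) => [r| |]// _ [] /eqP; rewrite eq_sym subr_eq0 => /eqP <-.
rewrite diracE; have [|A0] := boolP (0 \in A).
  rewrite inE => A0; apply/eqP; rewrite eq_le probability_le1//=.
  rewrite -S1; apply: le_measure; rewrite ?inE//.
  by move=> z ->.
apply: (@subset_measure0 _ _ _ rho _ [set~ 0]) => //.
by move=> z Az /= z0; move/negP: A0; apply; rewrite inE -z0.
Qed.

(** The variance of z^2 is nonnegative, so mu4 >= sigma^4. *)
Lemma mu4_gt0 : 0 < mu4.
Proof.
have s0 := sigma_gt0.
have mu4E' : (\int[rho]_z ((z ^+ 2) ^+ 2)%:E = mu4%:E)%E.
  by rewrite -mu4E; apply: eq_integral => z _; rewrite -exprM.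
have msq : measurable_fun setT (fun z : R => z ^+ 2) by exact: exprn_measurable.
have := integral_tsumf_centered_sqr 1 msq (fun z => sqr_ge0 z) sigmaE mu4E'.
set I := (\int[_]_x _)%E => IE.
have : (0 <= I)%E by apply: integral_ge0 => x _; rewrite lee_fin sqr_ge0.
rewrite IE lee_fin mul1r subr_ge0; apply: lt_le_trans.
by rewrite !exprn_gt0.
Qed.

End nondegenerate.

Section scale.
Context {R : realType}.

Definition root4 (k : nat) : R := k.+1%:R `^ (1 / 4).

Lemma root4_ge1 k : 1 <= root4 k.
Proof.
have h : (1 : R) `^ (1 / 4) = 1 by rewrite powR1.
by rewrite -[leLHS]h ge0_ler_powR ?nnegrE ?ler1n// divr_ge0.
Qed.

Lemma root4X4 k : root4 k ^+ 4 = k.+1%:R.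
Proof.
rewrite -powR_mulrn ?powR_ge0// -powRrM.
have -> : 1 / 4 * 4%:R = 1 :> R by field.
by rewrite powRr1.
Qed.

Lemma root4X3 k : root4 k ^+ 3 = k.+1%:R `^ (3 / 4).
Proof.
rewrite -powR_mulrn ?powR_ge0// -powRrM.
by have -> : 1 / 4 * 3%:R = 3 / 4 :> R by field.
Qed.

Lemma cvg_root4V2 : (root4 k ^- 2 @[k --> \oo] --> (0 : R)).
Proof.
have -> : (fun k => root4 k ^- 2) = (fun k => Num.sqrt (@harmonic R k)).
  apply/funext => k; have -> : harmonic k = (root4 k ^- 2) ^+ 2.
    by rewrite exprVn -exprM root4X4.
  by rewrite sqrtr_sqr ger0_norm// invr_ge0 sqr_ge0.
rewrite -[X in _ --> X](sqrtr0 R).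
by apply: cvg_comp; [exact: cvg_harmonic|exact: sqrt_continuous].
Qed.

End scale.

Section limit.
Context (R : realType) (rho : probability R R).
Hypothesis rho_sym : symmetric_measure rho.
Local Notation leb := (@lebesgue_measure R).
Variables (sigma mu4 mu6 mu8 : R).
Hypotheses (sigma0 : 0 < sigma).
Hypotheses (sigmaE : (\int[rho]_z (z ^+ 2)%:E = (sigma ^+ 2)%:E)%E)
  (mu4E : (\int[rho]_z (z ^+ 4)%:E = mu4%:E)%E)
  (mu6E : (\int[rho]_z (z ^+ 6)%:E = mu6%:E)%E)
  (mu8E : (\int[rho]_z (z ^+ 8)%:E = mu8%:E)%E).
Variables (f : R -> R) (M : R).
Hypotheses (cf : continuous f) (f0 : forall z, 0 <= f z) (fM : forall z, `|f z| <= M).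

Local Notation qk := (@root4 R).
Local Notation q1 := (@root4_ge1 R).
Local Notation q4 := (@root4X4 R).

Let mf : measurable_fun setT f. Proof. exact: continuous_measurable_fun. Qed.

Definition quartic_integral : \bar R :=
  (\int[leb]_s (f s * quartic_kernel sigma mu4 s)%:E)%E.

Lemma quartic_kernelE s : quartic_kernel sigma mu4 s = quartic_exp (mu4 / (12 * sigma ^+ 8)) s.
Proof.
rewrite /quartic_kernel /quartic_exp; congr (expR (- _)).
by field; rewrite gt_eqF.
Qed.

Lemma cvg_gap_density_mean s :
  (gap_density_mean rho sigma (qk k) k.+1 s @[k --> \oo] -->
   (quartic_kernel sigma mu4 s)%:E)%E.
Proof.
set h := quartic_kernel sigma mu4 s; set r := gap_rate sigma mu4 mu6 mu8 s.
have H k := gap_density_mean_dist sigma0 (q1 k) (q4 k) sigmaE mu4E mu6E mu8E s.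
apply: (@squeeze_cvge _ _ _ _ (fun k => (h - r * qk k ^- 2)%:E) _
   (fun k => (h + r * qk k ^- 2)%:E)).
- apply: nearW => k; have [H1 H2] := H k; rewrite H1 andbT EFinB leeBlDr//.
- apply: cvg_EFin; first exact: nearW.
  rewrite -[X in _ --> X]subr0 -[X in _ - X](mulr0 r).
  apply: cvgB; first exact: cvg_cst.
  by apply: cvgM; [exact: cvg_cst|exact: cvg_root4V2].
- apply: cvg_EFin; first exact: nearW.
  rewrite -[X in _ --> X]addr0 -[X in _ + X](mulr0 r).
  apply: cvgD; first exact: cvg_cst.
  by apply: cvgM; [exact: cvg_cst|exact: cvg_root4V2].
Qed.

(** Dominated convergence in s. *)
Lemma cvg_smoothed_integral :
  quartic_integral \is a fin_num /\
  (smoothed_integral rho sigma (qk k) k.+1 f @[k --> \oo] --> quartic_integral)%E.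
Proof.
have M0 : 0 <= M by apply: le_trans (fM 0).
have mh : measurable_fun setT (fun s => (f s * quartic_kernel sigma mu4 s)%:E).
  apply/measurable_EFinP/measurable_funM => //.
  have -> : quartic_kernel sigma mu4 = quartic_exp (mu4 / (12 * sigma ^+ 8)).
    by apply/funext => s; exact: quartic_kernelE.
  exact: measurable_quartic_exp.
have iD : leb.-integrable setT (fun s => (M * hs_dominant sigma s)%:E).
  apply/integrableP; split.
    by apply/measurable_EFinP/measurable_funM => //; exact: measurable_hs_dominant.
  under eq_integral do rewrite gee0_abs ?lee_fin ?mulr_ge0 ?hs_dominant_ge0//.
  rewrite integralZ_EFin//; last 2 first.
  - exact: measurable_hs_dominant.
  - by move=> s; exact: hs_dominant_ge0.
  by rewrite integral_hs_dominant// -EFinM ltry.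
pose F k s := ((f s)%:E * gap_density_mean rho sigma (qk k) k.+1 s)%E.
have mF k : measurable_fun setT (F k).
  apply: emeasurable_funM; first exact/measurable_EFinP.
  exact: measurable_gap_density_mean.
have ptw : {ae leb, forall s, setT s ->
    F ^~ s @ \oo --> (f s * quartic_kernel sigma mu4 s)%:E}.
  apply: aeW => s _; rewrite EFinM; apply: cvgeZl => //.
  exact: cvg_gap_density_mean.
have dom : {ae leb, forall s k, setT s -> (`|F k s| <= (M * hs_dominant sigma s)%:E)%E}.
  apply: aeW => s k _; rewrite gee0_abs; last first.
    by rewrite mule_ge0 ?lee_fin ?gap_density_mean_ge0.
  rewrite EFinM; apply: lee_pmul => //.
  - by rewrite lee_fin.
  - exact: gap_density_mean_ge0.
  - by rewrite lee_fin; apply: le_trans (ler_norm _) (fM s).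
  - exact: (gap_density_mean_le rho sigma0 (q1 k) (q4 k)).
have [ih _ cv] := @dominated_convergence _ (measurableTypeR R) R leb setT
  measurableT F _ _ mF mh ptw iD dom.
split; last exact: cv.
exact: integrable_fin_num ih.
Qed.

(** The error in [scaled_smoothed_dist] is at most e K + o(1) for every e > 0, with K
independent of n. *)
Lemma cvg_scaled_integral :
  (scaled_integral rho sigma (qk k) k.+1 f @[k --> \oo] --> quartic_integral)%E.
Proof.
have [Lfin Bcv] := cvg_smoothed_integral.
set A := fun k => scaled_integral rho sigma (qk k) k.+1 f.
set B := fun k => smoothed_integral rho sigma (qk k) k.+1 f in Bcv.
move: Lfin Bcv; case: quartic_integral => [L| |]// _ /fine_cvgP[Bfin Bcv].
have A0 k : (0 <= A k)%E.
  apply: integral_ge0 => x _; rewrite lee_fin mulr_ge0//.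
  by rewrite mulr_ge0 ?weight_ge0// ltW// (hs_mass_gt0 sigma0 (q1 k)).
have dist e c k : 0 <= e -> 0 <= c ->
  (forall a b, `|f a - f b| <= e * (1 + b ^+ 2) + c * (a - b) ^+ 2) -> _ :=
  fun e0 c0 fm => scaled_smoothed_dist rho_sym sigma0 (q1 k) (q4 k) sigmaE mu4E mf f0 e0 c0 fm.
have Afin : \forall k \near \oo, A k \is a fin_num.
  have [c c0 fm] := bounded_continuous_modulus cf fM ltr01.
  apply: filterS Bfin => k Bk; rewrite ge0_fin_numE//.
  have [h _] := dist 1 c k ler01 c0 fm.
  by apply: le_lt_trans h _; rewrite -/(B k) -(fineK Bk) -EFinD ltry.
apply/fine_cvgP; split => //.
apply/cvgrPdist_le => eta eta0.
pose K := dominant_mass sigma + dominant_moment sigma.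
have K0 : 0 <= K.
  by rewrite addr_ge0 ?dominant_mass_ge0// mulr_ge0 ?dominant_mass_ge0// mulr_ge0// sqr_ge0.
pose e := eta / 3 / (K + 1).
have e0 : 0 < e by rewrite !divr_gt0// ltr_wpDl.
have eK : e * K <= eta / 3.
  rewrite /e mulrAC ler_pdivrMr ?ltr_wpDl// ler_wpM2l ?lerDl//.
  by rewrite divr_ge0// ltW.
have [c c0 fm] := bounded_continuous_modulus cf fM e0.
have eta3 : 0 < eta / 3 by rewrite divr_gt0.
have er : (c * error_rate sigma mu4 * qk k ^- 2) @[k --> \oo] --> (0 : R).
  rewrite -[X in _ --> X](mulr0 (c * error_rate sigma mu4)).
  by apply: cvgM; [exact: cvg_cst|exact: cvg_root4V2].
move/cvgrPdist_le : er => /(_ _ eta3) er.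
move/cvgrPdist_le : Bcv => /(_ _ eta3) Bcv.
near=> k.
have Ak : A k \is a fin_num by near: k.
have Bk : B k \is a fin_num by near: k.
have hB : `|L - fine (B k)| <= eta / 3 by near: k.
have hE : `|0 - c * error_rate sigma mu4 * qk k ^- 2| <= eta / 3 by near: k.
have [h1 h2] := dist e c k (ltW e0) c0 fm.
rewrite -/(A k) -/(B k) in h1 h2.
rewrite -(fineK Ak) -(fineK Bk) -EFinD lee_fin in h1.
rewrite -(fineK Ak) -(fineK Bk) -EFinD lee_fin in h2.
rewrite /smoothing_error -/K mulrA in h1 h2.
move: hE; rewrite sub0r normrN => /(le_trans (ler_norm _)) hE.
move: hB; rewrite ler_norml => /andP[hB1 hB2].
rewrite /= ler_norml; apply/andP; split; lra.
Unshelve. all: by end_near. Qed.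

End limit.

(** * Expectations under the tilted law *)

Section law.
Context (R : realType) (rho : probability R R) (sigma : R).
Hypothesis sigma0 : 0 < sigma.
Context (d : measure_display) (T : measurableType d) (P : probability T R) (k : nat).
Variable X : {RV P >-> k.+1.-tuple R}.
Hypothesis X_law : forall A : set (k.+1.-tuple R), measurable A ->
  distribution P X A = mu_tilde rho A.
Local Notation mun := (power_prob rho k.+1).
Local Notation Z := (partition_function rho k.+1).

Let mw : measurable_fun setT (@weight R k.+1).
Proof. exact: measurable_weight. Qed.

(** As a real number the partition function is 0 when the integral of the weight is infinite,
and if it were 0 the law of X would have mass 0 instead of 1. *)
Lemma partition_functionE :
  0 < Z /\ (\int[mun]_x (weight x)%:E = Z%:E)%E.
Proof.
have w0 : (0 <= \int[mun]_x (weight x)%:E)%E.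
  by apply: integral_ge0 => x _; rewrite lee_fin weight_ge0.
have := X_law measurableT; rewrite probability_setT /mu_tilde.
rewrite /partition_function /Rintegral.
move: w0; case: (\int[mun]_x (weight x)%:E)%E => [r| |]//=; last first.
  by move=> _; rewrite invr0 mul0e => /eqP; rewrite onee_eq0.
rewrite lee_fin => r0; rewrite -EFinM => -[] r1; split => //.
rewrite lt_neqAle r0 andbT; apply/eqP => r2.
by move: r1; rewrite -r2 mulr0 => /eqP; rewrite oner_eq0.
Qed.

(** The factor hs_mass, common to both integrals, cancels in the quotient. *)
Lemma expectation_scaled_sum (f : R -> R) : measurable_fun setT f ->
  (forall z, 0 <= f z) ->
  ('E_P[f \o scaled_sum X] =
   scaled_integral rho sigma (root4 k) k.+1 f *
   ((fine (scaled_integral rho sigma (root4 k) k.+1 (fun=> 1)))^-1)%:E)%E.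
Proof.
move=> mf f0; have [Z0 ZE] := partition_functionE.
set hm := hs_mass sigma (root4 k).
have hm0 : 0 < hm by exact: (hs_mass_gt0 sigma0 (root4_ge1 k)).
have A1 : scaled_integral rho sigma (root4 k) k.+1 (fun=> 1) = (hm * Z)%:E.
  rewrite /scaled_integral; under eq_integral do rewrite mul1r.
  rewrite integralZ_EFin//; [by rewrite ZE|exact: weight_ge0|exact: ltW].
have mS : measurable_fun setT (fun x : k.+1.-tuple R => tsum x / k.+1%:R `^ (3 / 4)).
  by apply: measurable_funM => //; exact: measurable_tsum.
have mfS : measurable_fun setT (fun x : k.+1.-tuple R => f (tsum x / k.+1%:R `^ (3 / 4))).
  exact: (measurableT_comp mf mS).
have mZw : measurable_fun setT (fun x : k.+1.-tuple R => Z^-1 * weight x).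
  exact: measurable_funM.
have Zw0 x : 0 <= Z^-1 * @weight R k.+1 x.
  by rewrite mulr_ge0 ?weight_ge0// invr_ge0 ltW.
have lawE A : measurable A ->
    distribution P X A = (\int[mun]_(x in A) (Z^-1 * weight x)%:E)%E.
  move=> mA; rewrite X_law// /mu_tilde; under [RHS]eq_integral do rewrite EFinM.
  rewrite ge0_integralZl//.
  - by apply: measurable_funTS; exact/measurable_EFinP.
  - by move=> x _; rewrite lee_fin weight_ge0.
  - by rewrite lee_fin invr_ge0 ltW.
rewrite unlock.
transitivity (\int[distribution P X]_x (f (tsum x / k.+1%:R `^ (3 / 4)))%:E)%E.
  rewrite ge0_integral_distribution//; first exact/measurable_EFinP.
  by move=> x; rewrite lee_fin.
rewrite (ge0_integral_density mZw Zw0 lawE); last 2 first.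
- exact/measurable_EFinP.
- by move=> x; rewrite lee_fin.
rewrite A1 /= muleC /scaled_integral -/hm root4X3.
rewrite -integralZ_EFin; last 3 first.
- by apply: measurable_funM => //; exact: measurable_funM.
- by move=> x; rewrite mulr_ge0// mulr_ge0 ?weight_ge0// ltW.
- by rewrite invr_ge0 mulr_ge0// ltW.
apply: eq_integral => x _; rewrite -EFinM; congr (_%:E).
by field; rewrite !gt_eqF.
Qed.

End law.

Unset Implicit Arguments.
Set Strict Implicit.
Set Printing Implicit Defensive.

Theorem theorem2 (R : realType) (rho : probability R R)
    (rho_sym : symmetric_measure rho)
    (rho_neq0 : ~ is_dirac0 rho)
    (rho_exp : exists2 v0 : R, 0 < v0 &
       (\int[rho]_z (expR (v0 * z ^+ 2))%:E < +oo)%E)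
    (sigma mu4 : R)
    (sigma_ge0 : 0 <= sigma)
    (sigmaE : (sigma ^+ 2)%:E = (\int[rho]_z (z ^+ 2)%:E)%E)
    (mu4E : mu4%:E = (\int[rho]_z (z ^+ 4)%:E)%E)
    (d : nat -> measure_display) (T : forall n, measurableType (d n))
    (P : forall n, probability (T n) R)
    (X : forall n, {RV (P n) >-> n.-tuple R})
    (X_law : forall n, (0 < n)%N -> forall A : set (n.-tuple R),
       measurable A -> distribution (P n) (X n) A = mu_tilde rho A) :
  exists2 nu : probability R R,
    forall A : set R, measurable A ->
      nu A = (\int[lebesgue_measure]_(s in A) (limit_density sigma mu4 s)%:E)%E
    & cvg_in_distribution P (fun n => scaled_sum (X n)) nu.
Proof.
have sE := esym sigmaE; have m4E := esym mu4E.
have sigma0 : 0 < sigma := sigma_gt0 rho_neq0 sigma_ge0 sE.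
have mu40 : 0 < mu4 := mu4_gt0 rho_neq0 sigma_ge0 sE m4E.
have [mu6 _ mu6E] := even_moment_fin rho_exp 2.
have [mu8 _ mu8E] := even_moment_fin rho_exp 3.
set c := mu4 / (12 * sigma ^+ 8).
have c0 : 0 < c by rewrite divr_gt0// mulr_gt0// exprn_gt0.
have J0 := quartic_mass_gt0 c0.
have J1 : 0 <= (quartic_mass c)^-1 by rewrite invr_ge0 ltW.
have ldE s : limit_density sigma mu4 s = (quartic_mass c)^-1 * quartic_exp c s.
  by rewrite limit_densityE// mulrC.
have mld : measurable_fun setT (limit_density sigma mu4).
  rewrite (funext ldE); apply: measurable_funM => //.
  exact: measurable_quartic_exp.
have ld0 s : 0 <= limit_density sigma mu4 s.
  by rewrite ldE mulr_ge0// quartic_exp_ge0.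
have ld1 : (\int[@lebesgue_measure R]_s (limit_density sigma mu4 s)%:E = 1)%E.
  under eq_integral do rewrite ldE.
  rewrite integralZ_EFin//; last 2 first.
  - exact: measurable_quartic_exp.
  - exact: quartic_exp_ge0.
  by rewrite quartic_massE// -EFinM mulVf// gt_eqF.
have [nu nuE nuI] := probability_of_lebesgue_density mld ld0 ld1.
exists nu => // f cf bf.
have [M [Mreal bM]] := bf.
pose B := `|M| + 1.
have fB z : `|f z| <= B.
  by apply: (bM B) => //; rewrite /B; have := ler_norm M; lra.
have mf : measurable_fun setT f by exact: continuous_measurable_fun.
(* Nonnegative integrals suffice for g. *)
pose g z := f z + B.
have cg : continuous g.
  by move=> z; apply: cvgD; [exact: cf|exact: cvg_cst].
have mg : measurable_fun setT g by exact: continuous_measurable_fun.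
have g0 z : 0 <= g z by have := fB z; rewrite ler_norml /g => /andP[]; lra.
have gB z : `|g z| <= 2 * B.
  by rewrite ger0_norm// /g; have := ler_norm (f z); have := fB z; lra.
have -> : (\int[nu]_x (f x)%:E = \int[nu]_x (g x)%:E - B%:E)%E.
  exact: integral_prob_shift.
have -> : (fun n => 'E_(P n)[f \o scaled_sum (X n)])%E =
    (fun n => 'E_(P n)[g \o scaled_sum (X n)] - B%:E)%E.
  apply/funext => n; rewrite unlock.
  apply: (@integral_prob_shift _ _ _ _ (f \o scaled_sum (X n))).
    exact: measurableT_comp.
  by move=> w; exact: fB.
have nuG : (\int[nu]_x (g x)%:E =
    quartic_integral sigma mu4 g * ((quartic_mass c)^-1)%:E)%E.
  rewrite nuI; last 2 first.
  - exact/measurable_EFinP.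
  - by move=> x; rewrite lee_fin.
  rewrite muleC -integralZ_EFin; last 3 first.
  - apply: measurable_funM => //; rewrite (funext (quartic_kernelE _ sigma0)).
    exact: measurable_quartic_exp.
  - by move=> x; rewrite mulr_ge0// expR_ge0.
  - exact: J1.
  apply: eq_integral => s _; rewrite -EFinM ldE quartic_kernelE//.
  by congr (_%:E); ring.
have cvg1 := cvg_scaled_integral rho_sym sigma0 sE m4E mu6E mu8E.
have q1E : quartic_integral sigma mu4 (fun=> 1) = (quartic_mass c)%:E.
  rewrite -quartic_massE//; apply: eq_integral => s _.
  by rewrite mul1r quartic_kernelE.
have c1 : (scaled_integral rho sigma (root4 k) k.+1 (fun=> 1%R) @[k --> \oo] -->
    (quartic_mass c)%:E)%E.
  rewrite -q1E; apply: (cvg1 (fun=> 1) 1).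
  - by move=> z; exact: cvg_cst.
  - by [].
  - by move=> z; rewrite normr1.
have c2 := cvg1 g (2 * B) cg g0 gB.
have [gfin _] := cvg_smoothed_integral sigma0 sE m4E mu6E mu8E cg g0 gB.
have main : ('E_(P n)[g \o scaled_sum (X n)] @[n --> \oo] --> \int[nu]_x (g x)%:E)%E.
  rewrite nuG -cvg_shiftS /=.
  under eq_fun => k do rewrite (expectation_scaled_sum sigma0 (X_law k.+1 isT) mg g0).
  apply: cvgeM; [|exact: c2|].
    exact: mule_def_fin.
  apply: cvg_EFin; first exact: nearW.
  by apply: cvgV; [rewrite gt_eqF|exact: fine_cvg c1].
by apply: (cvgeB _ main (cvg_cst _)); exact: fin_num_adde_defl.
Qed.
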